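(* For every integer $m\ge 1$, $$\mathrm{m}_\mathbb{D}(x_1\cdots x_m+y)=\frac{1}{2^{m+1}}-\frac{1}{2}.$$ For all integers $m,n\ge 2$, \begin{align*} \mathrm{m}_\mathbb{D}(x_1\cdots x_m+y_1\cdots y_n)=&\frac{1}{4}+\binom{m+n-2}{m-1}\frac{1}{2^{m+n}}-\frac{1}{2^{m+n}} \sum_{r=0}^{n-1} \binom{m+n-3-r}{m-2} 2^r-\frac{1}{2^{m+n}} \sum_{r=0}^{m-1} \binom{m+n-3-r}{n-2} 2^r\\ &-\frac{m}{2^{m+n+1}}\sum_{r=0}^{n-1} \binom{m+n-1-r}{m} 2^r-\frac{n}{2^{m+n+1}} \sum_{r=0}^{m-1} \binom{m+n-1-r}{n} 2^r. \end{align*}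
   Context: For a nonzero rational function $P\in\mathbb{C}(x_1,\dots,x_n)$ in $n$ variables, the (logarithmic) areal Mahler measure is $\mathrm{m}_\mathbb{D}(P)=\frac{1}{\pi^n}\int_{\mathbb{D}^n}\log|P|\,dA(x_1)\cdots dA(x_n)$, where $\mathbb{D}=\{x\in\mathbb{C}:|x|\le 1\}$ and $dA$ is Lebesgue (area) measure on $\mathbb{C}$; here the polynomials are in the $m+n$ independent variables $x_1,\dots,x_m,y_1,\dots,y_n$ (respectively $m+1$ variables $x_1,\dots,x_m,y$). Binomial coefficients $\binom{a}{b}$ with $b>a\ge0$ are $0$. *)

(* Defs.v *)
From HB Require Import structures.
From mathcomp Require Import all_boot all_order all_algebra.
From mathcomp Require Import all_classical all_reals all_analysis.
From mathcomp Require Import complex.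
Set Implicit Arguments. Unset Strict Implicit. Unset Printing Implicit Defensive.
Import Order.TTheory GRing.Theory Num.Theory.
Local Open Scope ring_scope.
Local Open Scope classical_set_scope.

Section ArealMahler.
Variable R : realType.

Definition areaC : set (R * R) -> \bar R :=
  ((@lebesgue_measure R) \x (@lebesgue_measure R))%E.

Definition diskD : set (R * R) := [set z | z.1 ^+ 2 + z.2 ^+ 2 <= 1].

Definition toC (z : R * R) : R[i] := (z.1 +i* z.2)%C.

Definition setvar (k : nat) (w : R[i]) (v : nat -> R[i]) : nat -> R[i] :=
  fun j => if j == k then w else v j.

Fixpoint iter_disk_int (k : nat) (F : (nat -> R[i]) -> \bar R) (v : nat -> R[i])
  : \bar R :=
  match k with
  | 0 => F v
  | k'.+1 => (\int[areaC]_(z in diskD) iter_disk_int k' F (setvar k' (toC z) v))%E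
  end.

Definition mahlerD (k : nat) (P : (nat -> R[i]) -> R[i]) : \bar R :=
  ((pi ^- k)%:E * iter_disk_int k (fun v => (ln (ComplexField.Normc.normc (P v)))%:E) (fun _ => 0%R))%E.

End ArealMahler.

Definition P_xy (R : realType) (m : nat) (v : nat -> R[i]) : R[i] :=
  \prod_(i < m) v i + v m.

Definition P_xyy (R : realType) (m n : nat) (v : nat -> R[i]) : R[i] :=
  \prod_(i < m) v i + \prod_(j < n) v (m + j)%N.

(* Main.v *)
(* In polar coordinates [|x| ^ 2] is uniform on [[0, 1]] for [x] uniform in the unit disc, and by
   Jensen's formula the average of [ln |a x + b|] over the disc is that of [ln (max |a x| |b|)].
   The first average therefore replaces the polynomial by the maximum of the moduli of its two
   monomials, and the Mahler measure is the expectation of [- min (G_m, G_n) / 2] for independent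
   Gamma variables: [- 1/2 * \sum_(i < m, j < n) C(i + j, i) / 2 ^ (i + j + 1)].

   Jensen's formula is obtained without polar coordinates: area is invariant under rotations,
   which are products of shears, so replacing [ln |a x - b|] by [ln |(a x) ^ N - b ^ N|],
   [N = 2 ^ n], multiplies its integral by [N], while
   [ln |u ^ N - v ^ N| = N ln (max |u| |v|) + O(1)] with an integrable error not depending on [N]. *)
Require Import Defs.
From HB Require Import structures.
From mathcomp Require Import all_boot all_order all_algebra.
From mathcomp Require Import all_classical all_reals all_analysis.
From mathcomp Require Import complex.
From mathcomp Require Import measurable_realfun zify ring lra.
Set Implicit Arguments. Unset Strict Implicit. Unset Printing Implicit Defensive.
Import Order.TTheory GRing.Theory Num.Theory.
Import numFieldNormedType.Exports.
Local Open Scope ring_scope.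
Local Open Scope classical_set_scope.

(** * Negative binomial sums *)

(** Merging the two Poisson processes behind the Gamma variables turns the double sum into a race
    between the heads and the tails of a fair coin. The binomial sums of the statement are
    probabilities in that race, all determined by one of them up to single terms [nbin].

    The integrals are never exchanged: they are evaluated from the innermost variable outwards, the
    first monomial inside. Each inner value is needed in closed form where the second monomial does
    not vanish, and the excluded null set is met one variable at a time, as the origin of a disc.

    In Jensen's formula the exponents are powers of 2 because the rotation needed has [e ^ N = -1],
    and repeated complex square roots supply such an [e]. The logarithms are unbounded near the
    circle [|a x| = |b|]. The error there is governed by the logarithm of [||a x| ^ 2 - |b| ^ 2|],
    which is affine in the uniform variable [|x| ^ 2], hence integrable. *)

Section NegativeBinomial.
Variable R : realFieldType.

(** Probability that the [(i + 1)]-st head of a fair coin comes after exactly [j] tails;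
    [nbin_sum i n] is then the probability that this head precedes the [n]-th tail. *)
Definition nbin (i j : nat) : R := 'C(i + j, i)%:R / 2 ^+ (i + j).+1.

Definition nbin_sum (i n : nat) : R := \sum_(j < n) nbin i j.

Lemma nbinC i j : nbin i j = nbin j i.
Proof. by rewrite /nbin addnC -[in LHS](bin_sub (leq_addl j i)) addnK. Qed.

Lemma nbin0 j : nbin 0 j = 2^-1 ^+ j.+1.
Proof. by rewrite /nbin bin0 add0n mul1r exprVn. Qed.

Lemma nbinS i j : nbin i.+1 j.+1 = 2^-1 * (nbin i j.+1 + nbin i.+1 j).
Proof.
rewrite /nbin addSn binS addnS addSn natrD !exprS.
have p0 : 2 ^+ (i + j) != 0 :> R by rewrite expf_neq0 // pnatr_eq0.
by field.
Qed.

Lemma nbin_sumS i n : nbin_sum i n.+1 = nbin_sum i n + nbin i n.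
Proof. by rewrite /nbin_sum big_ord_recr. Qed.

(** In the coin race, the difference is the event that the [(n + 1)]-st tail finds exactly [i + 1]
    heads. *)
Lemma nbin_sumSl i n : nbin_sum i.+1 n.+1 = nbin_sum i n.+1 - nbin n i.+1.
Proof.
elim: n => [|n IH].
  rewrite /nbin_sum !big_ord1 /nbin !(addn0, add0n) !binn bin0 !exprS.
  have p0 : 2 ^+ i != 0 :> R by rewrite expf_neq0 // pnatr_eq0.
  by field.
rewrite [LHS]nbin_sumS IH [in RHS]nbin_sumS (nbinC n.+1 i.+1) nbinS (nbinC n).
by field.
Qed.

(** Either the [(i + 1)]-st head precedes the [(n + 1)]-st tail, or the reverse. *)
Lemma nbin_sum_compl i n : nbin_sum i n.+1 + nbin_sum n i.+1 = 1.
Proof.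
elim: i => [|i IH]; last by rewrite nbin_sumSl (nbin_sumS n); move: IH; lra.
rewrite {2}/nbin_sum big_ord1 nbinC nbin0.
elim: n => [|n IH]; first by rewrite /nbin_sum big_ord1 nbin0 expr1; field.
by rewrite nbin_sumS nbin0 -[RHS]IH !exprS; field.
Qed.

Lemma mul_nbin m n : m.+1%:R * nbin n m.+1 = n.+1%:R * nbin m n.+1.
Proof.
have E k l : k.+1%:R * nbin l k.+1 = ((k + l).+1 * 'C(k + l, k))%:R / 2 ^+ (k + l).+2.
  by rewrite nbinC /nbin addSn mulrA -natrM (mul_bin_diag (k + l).+1 k).
by rewrite !E addnC -[in LHS](bin_sub (leq_addl n m)) addnK.
Qed.

Lemma mul_nbinS m n : m.+1%:R * nbin m.+1 n = 2^-1 * ((m + n).+1%:R * nbin m n).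
Proof.
rewrite /nbin addSn [2 ^+ (m + n).+2]exprS.
have p0 : 2 ^+ (m + n).+1 != 0 :> R by rewrite expf_neq0 // pnatr_eq0.
transitivity ((m.+1 * 'C((m + n).+1, m.+1))%:R / (2 * 2 ^+ (m + n).+1) : R).
  by rewrite natrM mulrA.
by rewrite -mul_bin_diag natrM; field.
Qed.

(** The left side is the mean of [min (H, m + 1)], where [H] counts the heads before the
    [(n + 1)]-st tail. The last two terms are equal by [mul_nbin]; keeping both gives the symmetry
    of the final formula. In the induction, [mul_nbin] and [mul_nbinS] relate the boundary terms at
    [m] and [m + 1], and the rest is linear. *)
Lemma sum_nbin_sum m n : \sum_(i < m.+1) nbin_sum i n.+1 =
  m.+1%:R * nbin_sum m n.+1 + n.+1%:R * (1 - nbin_sum m n.+1)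
  - m.+1%:R * nbin n m.+1 - n.+1%:R * nbin m n.+1.
Proof.
elim: m => [|m IH].
  have c := nbin_sum_compl 0 n; have h := mul_nbin 0 n.
  have e : nbin_sum n 1 = 2^-1 ^+ n.+1.
    by rewrite /nbin_sum big_ord1 nbinC nbin0.
  have {e}c : 1 - nbin_sum 0 n.+1 = 2^-1 ^+ n.+1 by rewrite -e -c; ring.
  by rewrite big_ord1 c h nbin0 (exprS _ n.+1); field.
rewrite big_ord_recr /= IH nbin_sumSl.
have h1 := mul_nbin m n; have h2 := mul_nbin m.+1 n.
have h3 := mul_nbinS m.+1 n; rewrite nbinC [nbin m.+1 n]nbinC addSn in h3.
move: h1 h2 h3; rewrite -!natr1 natrD.
set s := nbin_sum _ _; set b := nbin _ _; set c := nbin _ _; set d := nbin _ _.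
rewrite add0r (_ : 1 + 1 = 2 :> R); [lra|by ring].
Qed.

Lemma sum_nbin_sum1 m :
  \sum_(i < m) nbin_sum i 1 = 1 - (2 ^+ m)^-1.
Proof.
elim: m => [|m IH]; first by rewrite big_ord0 expr0 invr1 subrr.
rewrite big_ord_recr /= IH /nbin_sum big_ord1 nbinC nbin0 exprVn exprS.
have p0 : 2 ^+ m != 0 :> R by rewrite expf_neq0// pnatr_eq0.
by field.
Qed.

End NegativeBinomial.

(** * Rotations, and the law of the squared modulus on the disc *)

Section AreaPreserving.
Variable R : realType.
Notation leb := (@lebesgue_measure R).
Notation T := (measurableTypeR R).

Lemma lebesgue_measure_shift (c : R) (A : set T) : measurable A ->
  leb ((fun x => x + c) @^-1` A) = leb A.
Proof.
move=> mA.
have ms : measurable_fun [set: T] (fun x : T => x + c : T).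
  by apply: measurable_funD.
symmetry; apply: (@lebesgue_measure_unique R (pushforward leb (fun x : T => x + c : T))) => //.
move=> _ [[a b] _ <-] /=; rewrite /pushforward.
rewrite (_ : (fun x : R => x + c) @^-1` _ = `]a - c, b - c]%classic); last first.
  by apply/seteqP; split => x /=; rewrite !in_itv /= ltrBlDr lerBrDr.
rewrite !lebesgue_measure_itv /= !lte_fin ltrD2r -!EFinB.
by rewrite (_ : b - c - (a - c) = b - a) //; ring.
Qed.

(* [areaC] with its structure of measure. *)
Definition area : {measure set (T * T) -> \bar R} := (leb \x leb)%E.

Definition area_preserving (f : T * T -> T * T) :=
  measurable_fun [set: T * T] f /\
  forall A : set (T * T), measurable A -> area (f @^-1` A) = area A.

Lemma area_preserving_comp f g :
  area_preserving f -> area_preserving g -> area_preserving (f \o g).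
Proof.
move=> [mf Hf] [mg Hg]; split; first exact: measurableT_comp.
move=> A mA; rewrite comp_preimage Hg ?Hf//.
by rewrite -[X in measurable X]setTI; exact: mf.
Qed.

Lemma area_preserving_rectangle f : measurable_fun [set: T * T] f ->
  (forall A B : set T, measurable A -> measurable B ->
    area (f @^-1` (A `*` B)) = (leb A * leb B)%E) -> area_preserving f.
Proof.
move=> mf Hf; split => // A mA; symmetry.
pose m : {measure set (T * T) -> \bar R} := pushforward area f.
exact: (@product_measure_unique _ _ T T R leb leb (m mf) Hf A mA).
Qed.

Lemma area_preserving_swap : area_preserving (fun z => (z.2, z.1)).
Proof.
apply: area_preserving_rectangle => [|A B mA mB].
  by apply: measurable_fun_pair.
rewrite (_ : _ @^-1` _ = B `*` A); last first.
  by apply/seteqP; split => -[x y] /= [].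
by rewrite /area /= product_measure1E// muleC.
Qed.

(** Over a point of [A], the vertical section of the preimage of a rectangle is a translate of [B];
    elsewhere it is empty. *)
Lemma area_preserving_yshear (k : R) :
  area_preserving (fun z => (z.1, z.2 + k * z.1)).
Proof.
apply: area_preserving_rectangle => [|A B mA mB].
  apply: measurable_fun_pair => //; apply: measurable_funD => //.
  exact: measurable_funM.
rewrite /area /= /product_measure1 /=.
under eq_integral => x _.
  rewrite (_ : _ (xsection _ x) = (\1_A x)%:E * leb B)%E; last first.
    rewrite indicE; have [xA|xA] := boolP (x \in A).
      rewrite mul1e -(lebesgue_measure_shift (k * x) mB); congr (leb _).
      apply/seteqP; split => y /=; rewrite /xsection /= inE /=.
        by case.
      by split => //; exact: set_mem xA.
    rewrite mul0e (_ : xsection _ _ = set0) ?measure0//.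
    apply/seteqP; split => y //=; rewrite /xsection /= inE /= => -[Ax _].
    by move: xA; rewrite notin_setE.
  over.
by rewrite ge0_integralZr ?integral_indic ?setIT//; exact: measurableT_comp.
Qed.

Lemma area_preserving_xshear (k : R) :
  area_preserving (fun z => (z.1 + k * z.2, z.2)).
Proof.
exact: area_preserving_comp area_preserving_swap
  (area_preserving_comp (area_preserving_yshear k) area_preserving_swap).
Qed.

Definition rotation (p q : R) (z : T * T) : T * T :=
  (p * z.1 - q * z.2, q * z.1 + p * z.2).

(* A rotation with [q != 0] is a product of three shears. *)
Lemma area_preserving_rotation (p q : R) : p ^+ 2 + q ^+ 2 = 1 ->
  area_preserving (rotation p q).
Proof.
have shears p' q' : q' != 0 -> p' ^+ 2 + q' ^+ 2 = 1 ->
    area_preserving (rotation p' q').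
  (* [t] is the tangent of half the rotation angle; [qt] and [tp] below are the half-angle
     identities. *)
  move=> q0 pq; pose t := (1 - p') / q'.
  rewrite (_ : rotation p' q' =
    (fun z : T * T => (z.1 + - t * z.2, z.2)) \o
    ((fun z : T * T => (z.1, z.2 + q' * z.1)) \o
     (fun z : T * T => (z.1 + - t * z.2, z.2)))).
    apply: area_preserving_comp; first exact: area_preserving_xshear.
    by apply: area_preserving_comp;
      [exact: area_preserving_yshear|exact: area_preserving_xshear].
  apply/funext => -[x y]; rewrite /rotation /=.
  have qt : q' * t = 1 - p' by rewrite /t; field.
  have tp : t * (1 + p') = q'.
    rewrite /t mulrAC (_ : (1 - p') * (1 + p') = q' ^+ 2); last first.
      by rewrite -[q' ^+ 2](addrK (p' ^+ 2)) addrC [q' ^+ 2 + _]addrC pq; ring.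
    by field.
  congr (_, _).
    transitivity ((1 - q' * t) * x - (t * (2 - q' * t)) * y); last by ring.
    by rewrite qt (_ : 2 - (1 - p') = 1 + p') ?tp; ring.
  transitivity (q' * x + (1 - q' * t) * y); last by ring.
  by rewrite qt; ring.
have [->|q0] := eqVneq q 0; last exact: shears.
rewrite expr0n /= addr0 => /eqP; rewrite sqrf_eq1 => /orP[] /eqP ->.
  rewrite (_ : rotation 1 0 = id).
    by split => [|A mA]; [exact: measurable_id|rewrite preimage_id].
  by apply/funext => -[x y]; rewrite /rotation /=; congr (_, _); ring.
(* The half turn has [q = 0], but it is the square of a quarter turn, to which the three shears
   apply. *)
rewrite (_ : rotation (-1) 0 = rotation 0 1 \o rotation 0 1).
  by apply: area_preserving_comp; apply: shears; rewrite ?oner_neq0//; ring.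
by apply/funext => -[x y]; rewrite /rotation /=; congr (_, _); ring.
Qed.

Lemma measurable_diskD : measurable (@diskD R : set (T * T)).
Proof.
rewrite (_ : @diskD R = (fun z : T * T => z.1 ^+ 2 + z.2 ^+ 2 : T) @^-1` `]-oo, 1]); last first.
  by apply/seteqP; split => z /=; rewrite in_itv.
rewrite -[X in measurable X]setTI.
have : measurable_fun [set: T * T] (fun z : T * T => z.1 ^+ 2 + z.2 ^+ 2 : T).
  by apply: measurable_funD; apply: measurable_funX.
by apply.
Qed.

Lemma integral_area_preserving f (E : set (T * T)) (phi : T * T -> \bar R) :
  area_preserving f -> measurable E -> measurable_fun setT phi ->
  area.-integrable (f @^-1` E) (phi \o f) ->
  (\int[area]_(z in f @^-1` E) phi (f z) = \int[area]_(z in E) phi z)%E.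
Proof.
move=> [mf Hf] mE mphi iphi.
rewrite -[LHS](integral_pushforward mf mphi iphi mE).
by apply: eq_measure_integral => A mA _; exact: Hf.
Qed.

Lemma FTC2_is_derive (f F : R -> R) (a b : R) : a < b ->
  (forall x, x \in `[a, b]%R -> is_derive x 1 F (f x)) ->
  {within `[a, b], continuous f} ->
  (\int[leb]_(x in `[a, b]) (f x)%:E = (F b - F a)%:E)%E.
Proof.
move=> ab dF cf; rewrite EFinB; apply: continuous_FTC2 => //.
  have cF x : x \in `[a, b]%R -> {for x, continuous F}.
    move=> xab; apply: differentiable_continuous; apply/derivable1_diffP.
    by have := dF x xab; case.
  split.
  - move=> x xab; have := dF x (subset_itv_oo_cc xab).
    by case.
  - by apply: cvg_at_right_filter; apply: cF; rewrite in_itv /= lexx ltW.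
  - by apply: cvg_at_left_filter; apply: cF; rewrite in_itv /= lexx ltW.
by move=> x xab; rewrite derive1E; have := dF x (subset_itv_oo_cc xab) => h; rewrite derive_val.
Qed.

(** The integrand is the length of a vertical chord of the disc of radius [r]; the substitution
    [x = r * sin t] turns it into a multiple of [cos t ^ 2]. *)
Lemma half_disk_area (r : R) : 0 <= r ->
  (\int[leb]_(x in `[(- r)%R, r]) (2 * Num.sqrt (r ^+ 2 - x ^+ 2))%:E = (pi * r ^+ 2)%:E)%E.
Proof.
rewrite le_eqVlt => /predU1P[<-|r0].
  by rewrite oppr0 set_itv1 integral_set1 expr0n mulr0.
pose F (t : R) := r * sin t.
have dF t : is_derive t (1 : R) F (r * cos t).
  by rewrite /F; apply: is_derive_eq; rewrite /GRing.scale /=; ring.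
have F'E : F^`() = (fun t => r * cos t).
  by apply/funext => t; rewrite derive1E derive_val.
have cF' : continuous F^`().
  rewrite F'E => t; apply: cvgM; first exact: cvg_cst.
  exact: continuous_cos.
have FN : F (- (pi / 2)) = - r by rewrite /F sinN sin_pihalf mulrN1.
have FP : F (pi / 2) = r by rewrite /F sin_pihalf mulr1.
have ppi : 0 < pi :> R by exact: pi_gt0.
have lpi : - (pi / 2) < pi / 2 :> R by lra.
have cG : continuous (fun x : R => 2 * Num.sqrt (r ^+ 2 - x ^+ 2)).
  move=> x; apply: cvgM; first exact: cvg_cst.
  apply: continuous_comp; last exact: sqrt_continuous.
  by apply: cvgB; [exact: cvg_cst|exact: exprn_continuous].
have := @integration_by_substitution_increasing R F
  (fun x => 2 * Num.sqrt (r ^+ 2 - x ^+ 2)) _ _ (ltW lpi).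
rewrite FN FP => ->; first last.
- exact: continuous_subspaceT.
- split.
  + by move=> t _; have := dF t; case.
  + apply: cvg_at_right_filter; apply: differentiable_continuous.
    by apply/derivable1_diffP; have := dF (- (pi / 2)); case.
  + apply: cvg_at_left_filter; apply: differentiable_continuous.
    by apply/derivable1_diffP; have := dF (pi / 2); case.
- by apply: cvgP; apply: cvg_at_left_filter; exact: cF'.
- by apply: cvgP; apply: cvg_at_right_filter; exact: cF'.
- by move=> t _; exact: cF'.
- move=> s t; rewrite !in_itv /= => /andP[s1 s2] /andP[t1 t2] st.
  by rewrite /F ltr_pM2l// ltr_sin// in_itv /= ?s1 ?t1.
transitivity (\int[leb]_(t in `[(- (pi / 2))%R, (pi / 2)%R]) (2 * r ^+ 2 * cos t ^+ 2)%:E)%E.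
  apply: eq_integral => t; rewrite inE /= in_itv /= => tI; congr (_%:E).
  rewrite F'E; change (2 * Num.sqrt (r ^+ 2 - (r * sin t) ^+ 2) * (r * cos t) = 2 * r ^+ 2 * cos t ^+ 2).
  rewrite exprMn (_ : r ^+ 2 - r ^+ 2 * sin t ^+ 2 = (r * cos t) ^+ 2).
    rewrite sqrtr_sqr ger0_norm; last by rewrite mulr_ge0 ?(ltW r0)// cos_ge0_pihalf.
    by ring.
  by rewrite exprMn cos2sin2; ring.
pose P t := r ^+ 2 * (t + sin t * cos t).
have dP t : is_derive t (1 : R) P (2 * r ^+ 2 * cos t ^+ 2).
  by rewrite /P; apply: is_derive_eq; rewrite /GRing.scale /= -[X in X + _](cos2Dsin2 t); ring.
rewrite (FTC2_is_derive lpi (fun t _ => dP t)).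
- by rewrite /P sinN sin_pihalf cosN cos_pihalf; congr (_%:E); field.
- apply: continuous_subspaceT => t; apply: cvgM; first exact: cvg_cst.
  by apply: (@continuous_comp _ _ _ cos (fun x => x ^+ 2)); [exact: continuous_cos|exact: exprn_continuous].
Qed.

Definition sqn (z : T * T) : T := z.1 ^+ 2 + z.2 ^+ 2.

Lemma measurable_sqn : measurable_fun [set: T * T] sqn.
Proof. by apply: measurable_funD; apply: measurable_funX. Qed.

Lemma area_disk (t : R) : 0 <= t ->
  (area (sqn @^-1` `]-oo, t]) = (pi * t)%:E)%E.
Proof.
move=> t0; have := half_disk_area (sqrtr_ge0 t); rewrite sqr_sqrtr// => <-.
rewrite /area /= /product_measure1 [RHS]integral_mkcond.
apply: eq_integral => x _; rewrite /= patchE /=.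
have xE : (x ^+ 2 <= t) = (`|x| <= Num.sqrt t).
  by rewrite -sqrtr_sqr ler_sqrt.
case: ifPn; rewrite ?notin_setE ?inE /= in_itv /= -ler_norml -xE => xt.
  have tx : 0 <= t - x ^+ 2 by rewrite subr_ge0.
  rewrite (_ : xsection _ x = `[- Num.sqrt (t - x ^+ 2), Num.sqrt (t - x ^+ 2)]%classic).
    rewrite lebesgue_measure_itv /= lte_fin; case: ltP => [_|].
      by rewrite -EFinB; congr (_%:E); ring.
    have := sqrtr_ge0 (t - x ^+ 2) => h1 h2.
    by rewrite (_ : Num.sqrt _ = 0) ?mulr0//; lra.
  apply/seteqP; split => y; rewrite /xsection /= inE /= /sqn !in_itv /= -ler_norml -sqrtr_sqr ler_sqrt//;
    by rewrite lerBrDl.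
rewrite (_ : xsection _ x = set0) ?measure0//.
apply/seteqP; split => y //=; rewrite /xsection /= inE /= /sqn in_itv /= => h.
apply: xt; apply: le_trans h; by rewrite lerDl sqr_ge0.
Qed.

(** Both sides are measures in [A]. By [area_disk] they agree, with finite values, on the rays
    []-oo, b]], hence on the differences []a, b]], which determine a measure. *)
Lemma pushforward_sqn (A : set T) : measurable A ->
  (area (sqn @^-1` A) = pi%:E * leb (A `&` `[0%R, +oo[))%E.
Proof.
move=> mA.
have pi0 : 0 <= pi :> R by exact: pi_ge0.
have m0 : measurable (`[0%R, +oo[%classic : set T) by exact: measurable_itv.
pose m1 : {measure set T -> \bar R} := pushforward area sqn.
pose m2 : {measure set T -> \bar R} := mscale (NngNum pi0) (mrestr leb m0).
suff : m1 measurable_sqn A = m2 A by [].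
have mS (I : set T) : measurable I -> measurable (sqn @^-1` I).
  by move=> mI; rewrite -[X in measurable X]setTI; exact: measurable_sqn.
have sqn0 z : 0 <= sqn z by rewrite /sqn addr_ge0 ?sqr_ge0.
have m1E X : m1 measurable_sqn X = area (sqn @^-1` X) by [].
have m2E X : m2 X = (pi%:E * leb (X `&` `[0%R, +oo[))%E by [].
have posI (b : R) : `]-oo, b] `&` `[0%R, +oo[ = `[0%R, b]%classic.
  apply/seteqP; split => z /=; rewrite !in_itv /= andbT; first by move=> [-> ->].
  by move=> /andP[-> ->].
have m12 (b : R) : m1 measurable_sqn `]-oo, b] = m2 `]-oo, b].
  rewrite m1E m2E posI; have [b0|b0] := ltP b 0.
    rewrite (_ : _ @^-1` _ = set0) ?measure0; last first.
      apply/seteqP; split => z //=; rewrite in_itv /= => zb.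
      by have := sqn0 z; rewrite leNgt (le_lt_trans zb).
    by rewrite set_itv_ge ?measure0 ?mule0// bnd_simp -ltNge.
  rewrite area_disk// lebesgue_measure_itv /= lte_fin EFinM; case: ltP => b0'.
    by rewrite sube0.
  by rewrite (_ : b = 0) //; apply/eqP; rewrite eq_le b0 b0'.
have m2oo (b : R) : (m2 `]-oo, b] < +oo)%E.
  rewrite m2E posI lebesgue_measure_itv /=.
  by case: ifP => _; rewrite ?mule0 ?ltry// sube0 -EFinM ltry.
have itvD (a b : R) : `]a, b]%classic = `]-oo, b] `\` `]-oo, a].
  apply/seteqP; split => z /=; rewrite !in_itv /=.
    by move=> /andP[az ->]; split => //; rewrite leNgt az.
  by move=> [-> /negP]; rewrite -ltNge => ->.
apply: (@measure_unique _ R T (@ocitv R) (fun k => `]- k%:R, k%:R]%classic) _ _ _ _ (m1 measurable_sqn) m2) => //.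
- exact: ocitvI.
- by move=> i; exists (- i%:R, i%:R).
- apply/seteqP; split => // x _; exists (Num.bound `|x|) => //=.
  have xk : `|x| < (Num.bound `|x|)%:R by rewrite archi_boundP.
  by move: xk; rewrite in_itv /= ltr_norml => /andP[-> /ltW].
- move=> _ [[a b] _ <-] /=; rewrite itvD.
  have m1oo : (m1 measurable_sqn `]-oo, b] < +oo)%E by rewrite m12.
  have mray (x : R) : measurable (`]-oo, x]%classic : set T).
    exact: measurable_itv.
  rewrite (measureD (mray b) (mray a) m1oo) (measureD (mray b) (mray a) (m2oo b)).
  have -> : `]-oo, b] `&` `]-oo, a] = `]-oo, Num.min b a]%classic.
    apply/seteqP; split => z /=; rewrite !in_itv /= le_min; first by move=> [-> ->].
    by move=> /andP[-> ->].
  by congr (_ - _)%E; exact: m12.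
- move=> k; apply: le_lt_trans (m2oo k%:R); rewrite -m12; apply: le_measure.
  + by rewrite inE; exact: measurable_itv.
  + by rewrite inE; exact: measurable_itv.
  + by move=> z /=; rewrite !in_itv /= => /andP[].
Qed.

Lemma diskD_sqn : @diskD R = sqn @^-1` `[0%R, 1%R].
Proof.
apply/seteqP; split => z /=; rewrite in_itv /=; last by move=> /andP[].
by move=> h; rewrite h andbT /sqn addr_ge0 ?sqr_ge0.
Qed.

Lemma ge0_integral_diskD_sqn (phi : T -> \bar R) : measurable_fun setT phi ->
  (forall t, 0 <= phi t)%E ->
  (\int[area]_(z in @diskD R) phi (sqn z) =
   pi%:E * \int[leb]_(t in `[0%R, 1%R]) phi t)%E.
Proof.
move=> mphi phi0.
have m01 : measurable (`[0%R, 1%R]%classic : set T) by exact: measurable_itv.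
have mphi01 : measurable_fun (`[0%R, 1%R]%classic : set T) phi.
  exact: measurable_funTS.
have pi0 : 0 <= pi :> R by exact: pi_ge0.
rewrite diskD_sqn.
rewrite -[LHS](ge0_integral_pushforward measurable_sqn area m01 mphi01)//.
rewrite -(@ge0_integral_mscale _ T R leb _ m01 (NngNum pi0))//.
apply: eq_measure_integral; first exact: measurable_sqn.
move=> msqn A mA A01.
transitivity (area (sqn @^-1` A)) => //; rewrite pushforward_sqn//.
rewrite /mscale /=; congr (_ * leb _)%E.
apply/setIidPl => t /A01 /=; rewrite !in_itv /= => /andP[->]//.
Qed.

Lemma integrable_diskD_sqn (phi : T -> R) : measurable_fun setT phi ->
  leb.-integrable `[0%R, 1%R] (EFin \o phi) ->
  area.-integrable (@diskD R) (fun z => (phi (sqn z))%:E).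
Proof.
move=> mphi /integrableP[_ iphi]; apply/integrableP; split.
  apply/measurable_EFinP; apply: measurable_funTS.
  exact: measurableT_comp measurable_sqn.
rewrite (ge0_integral_diskD_sqn (phi := fun t => `|(phi t)%:E|%E))//.
  by apply: lte_mul_pinfty => //; rewrite lee_fin pi_ge0.
by apply: measurableT_comp => //; exact/measurable_EFinP.
Qed.

(* The squared modulus of a uniform point of the unit disc is uniform on [[0, 1]]. *)
Lemma integral_diskD_sqn (phi : T -> R) : measurable_fun setT phi ->
  leb.-integrable `[0%R, 1%R] (EFin \o phi) ->
  (\int[area]_(z in @diskD R) (phi (sqn z))%:E =
   pi%:E * \int[leb]_(t in `[0%R, 1%R]) (phi t)%:E)%E.
Proof.
move=> mphi iphi.
have mphiE : measurable_fun setT (EFin \o phi) by exact/measurable_EFinP.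
rewrite integralE [in RHS]integralE.
have pE : ((fun z => (phi (sqn z))%:E)^\+ =
    (fun z => (EFin \o phi)^\+ (sqn z)))%E.
  by apply/funext => z; rewrite !funeposE.
have nE : ((fun z => (phi (sqn z))%:E)^\- =
    (fun z => (EFin \o phi)^\- (sqn z)))%E.
  by apply/funext => z; rewrite !funenegE.
rewrite pE nE.
rewrite !ge0_integral_diskD_sqn//; [|exact: measurable_funeneg|exact: measurable_funepos].
have m01 : measurable (`[0%R, 1%R]%classic : set T) by exact: measurable_itv.
rewrite [RHS]muleBr//; apply: fin_num_adde_defr.
exact: integrable_pos_fin_num.
Qed.

End AreaPreserving.

(** * Jensen's formula on the disc *)

Section LogIntegrability.
Variable R : realType.
Notation leb := (@lebesgue_measure R).
Notation T := (measurableTypeR R).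

Lemma expRN_le_half (n : nat) : expR (- n%:R) <= 2 ^- n :> R.
Proof.
rewrite expRN lef_pV2 ?posrE ?expR_gt0 ?exprn_gt0// -[n%:R]mul1r mulrC expRM_natl.
apply: lerXn2r; rewrite ?nnegrE ?expR_ge0//.
by apply: le_trans (expR_ge1Dx 1); lra.
Qed.

(* For [0 < u < 1], [- ln u] is at most the number of [n] with [u <= 2 ^- n], and these
   level sets have summable measures. *)
Lemma integrable_ln_affine (a b : R) : 0 < a ->
  leb.-integrable `[0%R, 1%R] (EFin \o (fun t => ln `|a * t - b|)).
Proof.
move=> a0.
have m01 : measurable (`[0%R, 1%R]%classic : set T) by exact: measurable_itv.
have maff : measurable_fun [set: T] (fun t : T => `|a * t - b| : T).
  by apply: measurableT_comp => //; apply: measurable_funB => //;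
    exact: measurable_funM.
have mf : measurable_fun [set: T] (fun t : T => ln `|a * t - b| : T).
  exact: measurableT_comp (@measurable_ln R) maff.
apply/integrableP; split.
  by apply/measurable_EFinP; exact: measurable_funTS.
pose E n := `[(b - 2 ^- n) / a, (b + 2 ^- n) / a]%classic : set T.
have mE n : measurable (E n) by exact: measurable_itv.
have EP n t : E n t = (`|a * t - b| <= 2 ^- n) :> Prop.
  rewrite /E /= in_itv /= ler_pdivrMr// ler_pdivlMr// ler_norml.
  move: (2 ^- n) => p; rewrite (mulrC t).
  by congr (is_true (_ && _)); apply/idP/idP; lra.
(* The length is [2 * 2 ^- n / a], written with [2 ^ (n + 1)] to fit the geometric series summed at
   the end. *)
have lE n : leb (E n) = (4 / a / (2 ^ (n + 1))%:R)%:E.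
  rewrite /E lebesgue_measure_itv /= lte_fin ltr_pM2r ?invr_gt0//.
  have p2 : 0 < 2 ^- n :> R by rewrite invr_gt0 exprn_gt0.
  rewrite ifT; last by lra.
  rewrite -EFinB natrX exprD expr1; congr (_%:E).
  have : 2 ^+ n != 0 :> R by rewrite expf_neq0 // pnatr_eq0.
  by have := lt0r_neq0 a0 => ? ?; field; apply/andP.
pose g t : \bar R := (\sum_(0 <= n <oo) (\1_(E n) t)%:E)%E.
have mg : measurable_fun (`[0%R, 1%R]%classic : set T) g.
  apply: ge0_emeasurable_sum => [n t _ _|n _]; first by rewrite lee_fin.
  by apply/measurable_EFinP; exact: measurable_funTS.
pose C := `|ln (a + `|b|)|.
have fg t : `[0%R, 1%R]%classic t -> (`|(ln `|a * t - b|)%:E| <= C%:E + g t)%E.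
  rewrite /= in_itv /= => /andP[t0 t1].
  have ub : `|a * t - b| <= a + `|b|.
    apply: le_trans (ler_normB _ _) _; rewrite lerD2r normrM gtr0_norm// ger0_norm//.
    by rewrite ler_piMr// ltW.
  have g0 : (0 <= g t)%E.
    by apply: nneseries_ge0 => n _ _; rewrite lee_fin.
  set u := `|a * t - b| in ub *.
  have [u1|u1] := leP 1 u.
    rewrite ger0_norm ?ln_ge0//; apply: le_trans (leeDl _ g0).
    have up : 0 < u by apply: lt_le_trans u1.
    rewrite lee_fin (le_trans _ (ler_norm _))// ler_ln ?posrE//.
    exact: lt_le_trans ub.
  have [u0|u0] := eqVneq u 0.
    by rewrite u0 ln0// normr0 adde_ge0// lee_fin /C.
  have up : 0 < u by rewrite lt_neqAle eq_sym u0 normr_ge0.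
  have lnu : 0 <= - ln u by rewrite oppr_ge0 ln_le0// ltW.
  rewrite ler0_norm -?oppr_ge0//; apply: le_trans (leeDr _ _); last first.
    by rewrite lee_fin /C.
  (* The point [t] lies in [E 0], ..., [E k], because [u <= exp (- n) <= 2 ^- n] for [n <= k]; hence
     [g t >= k + 1 > - ln u]. *)
  pose k := Num.truncn (- ln u).
  have /andP[k1 k2] : k%:R <= - ln u < k.+1%:R by exact: truncn_itv.
  rewrite /g (@nneseries_split _ _ 0 k.+1); last by move=> n _; rewrite lee_fin.
  rewrite -[leLHS]adde0; apply: leeD; last first.
    by apply: nneseries_ge0 => n _ _; rewrite lee_fin.
  rewrite add0n (eq_big_nat _ _ (F2 := fun _ => 1%:E)).
    rewrite sumEFin lee_fin big_const_nat subn0 iter_addr addr0.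
    exact: ltW.
  move=> n /andP[_ nk]; rewrite indicE mem_set// EP -/u.
  apply: le_trans (expRN_le_half n); rewrite -[leLHS]lnK ?posrE// ler_expR lerNr.
  apply: le_trans k1; rewrite ler_nat; exact: nk.
apply: (@le_lt_trans _ _ (\int[leb]_(t in `[0%R, 1%R]) (C%:E + g t))%E).
  apply: ge0_le_integral => //.
  - by apply: measurableT_comp => //; apply/measurable_EFinP; exact: measurable_funTS.
  - exact: emeasurable_funD.
rewrite ge0_integralD//=; last 2 first.
- by move=> t _; rewrite lee_fin /C.
- by move=> t _; apply: nneseries_ge0 => n _ _; rewrite lee_fin.
rewrite integral_cst//= lebesgue_measure_itv /= lte_fin ltr01 sube0 mule1.
apply: lte_add_pinfty; first exact: ltry.
rewrite integral_nneseries//; last first.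
  by move=> n; apply/measurable_EFinP; exact: measurable_funTS.
apply: (@le_lt_trans _ _ (\sum_(0 <= n <oo) (4 / a / (2 ^ (n + 1))%:R)%:E)%E).
  apply: lee_nneseries => [n _ _|n _].
    by apply: integral_ge0 => t _; rewrite lee_fin.
  rewrite integral_indic// -lE; apply: le_measure; rewrite ?inE//.
  exact: measurableI.
rewrite (cvg_lim _ (@cvg_geometric_eseries_half R (4 / a) 0))//.
by rewrite expr0 ltry.
Qed.

End LogIntegrability.

(** * Moduli of differences of powers *)

Section ComplexModulus.
Variable R : realType.
Notation normc := ComplexField.Normc.normc.
Implicit Types u v w : R[i].

Lemma normc_ge0 w : 0 <= normc w.
Proof. by case: w => x y; exact: sqrtr_ge0. Qed.

Lemma sqr_normcE w : normc w ^+ 2 = complex.Re w ^+ 2 + complex.Im w ^+ 2.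
Proof. by case: w => x y /=; rewrite sqr_sqrtr// addr_ge0 ?sqr_ge0. Qed.

Lemma normc_toC (z : R * R) : normc (toC z) ^+ 2 = sqn z.
Proof. by rewrite sqr_normcE. Qed.

Lemma normc_eq0 w : (normc w == 0) = (w == 0).
Proof.
apply/eqP/eqP => [/ComplexField.Normc.eq0_normc//|->].
exact: ComplexField.Normc.normc0.
Qed.

Lemma normcX w n : normc (w ^+ n) = normc w ^+ n.
Proof.
elim: n => [|n IH]; first by rewrite !expr0 ComplexField.Normc.normc1.
by rewrite !exprS ComplexField.Normc.normcM IH.
Qed.

Lemma normc_leB u v : normc (u - v) <= normc u + normc v.
Proof. by rewrite -(normcN v); exact: le_normcD. Qed.

Lemma normc_geB u v : `|normc u - normc v| <= normc (u - v).
Proof.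
have h (x y : R[i]) : normc x <= normc (x - y) + normc y.
  by rewrite -[X in normc X <= _](subrK y); exact: le_normcD.
rewrite ler_norml; apply/andP; split; have := h u v; have := h v u.
  by rewrite -(normcN (v - u)) opprB; lra.
lra.
Qed.

(** For [r <= s], replacing [r ^ n] by [s ^ n] in [r ^ n * r] leaves [s ^ n * (s - r)]. *)
Lemma subX_ge (s r : R) n : 0 <= s -> 0 <= r ->
  Num.max s r ^+ n * `|s - r| <= `|s ^+ n.+1 - r ^+ n.+1|.
Proof.
wlog rs : s r / r <= s => [wl s0 r0|s0 r0].
  have /orP[rs|sr] := le_total r s; first exact: wl.
  by rewrite maxC distrC [leRHS]distrC; exact: wl.
have rsX : r ^+ n <= s ^+ n by exact: lerXn2r.
rewrite max_l// ger0_norm ?subr_ge0// ger0_norm ?subr_ge0; last exact: lerXn2r.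
by rewrite !exprSr mulrBr lerD2l lerN2 ler_wpM2r.
Qed.

(* [|u ^ N - v ^ N|] lies between [M ^ (N - 1) * ||u| - |v||] and [2 * M ^ N] where
   [M = max |u| |v|]; the squares appear because [|toC z| ^ 2] is what is uniform on the disc. *)
Lemma ln_normc_subX u v n : v != 0 -> normc u ^+ 2 != normc v ^+ 2 ->
  `|ln (normc (u ^+ n.+1 - v ^+ n.+1)) -
     n.+1%:R * (2^-1 * ln (Num.max (normc u ^+ 2) (normc v ^+ 2)))| <=
  ln 2 + `|ln `|normc u ^+ 2 - normc v ^+ 2| | +
    `|ln (Num.max (normc u ^+ 2) (normc v ^+ 2))|.
Proof.
move=> v0 uv; set s := normc u; set r := normc v; set d := normc (_ - _).
have r0 : 0 < r by rewrite lt_neqAle eq_sym normc_eq0 v0 normc_ge0.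
have s0 : 0 <= s by exact: normc_ge0.
pose M := Num.max s r.
have M0 : 0 < M by rewrite /M lt_max r0 orbT.
have M2 : Num.max (s ^+ 2) (r ^+ 2) = M ^+ 2.
  rewrite /M; have [sr|rs] := leP s r.
    by rewrite max_r// lerXn2r// ?nnegrE// ltW.
  by rewrite max_l// lerXn2r// ?nnegrE// ltW.
have sM : s <= M by rewrite /M le_max lexx.
have rM : r <= M by rewrite /M le_max lexx orbT.
have lnM2 : ln (M ^+ 2) = 2 * ln M by rewrite lnXn// mulr_natl.
have e0 : 0 < `|s ^+ 2 - r ^+ 2| by rewrite normr_gt0 subr_eq0.
(* Trades [|s - r|] for the difference of squares, which is affine in the squared modulus and so
   falls under [integrable_ln_affine]. *)
have le : `|s ^+ 2 - r ^+ 2| <= 2 * M * `|s - r|.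
  by rewrite subr_sqr normrM mulrC ler_wpM2r// ger0_norm; lra.
have du : d <= 2 * M ^+ n.+1.
  apply: le_trans (normc_leB _ _) _; rewrite !normcX mulr_natl mulr2n.
  by apply: lerD; apply: lerXn2r => //; rewrite nnegrE ltW.
have dl : M ^+ n * `|s - r| <= d.
  apply: le_trans (subX_ge n s0 (ltW r0)) _.
  by rewrite -!normcX; exact: normc_geB.
have sr0 : 0 < `|s - r|.
  by rewrite normr_gt0 subr_eq0; apply: contra uv => /eqP; rewrite -/s -/r => ->.
have d0 : 0 < d by apply: lt_le_trans dl; rewrite mulr_gt0 ?exprn_gt0.
have lnu : ln d <= ln 2 + n.+1%:R * ln M.
  have : ln d <= ln (2 * M ^+ n.+1).
    by rewrite ler_ln ?posrE// mulr_gt0// exprn_gt0.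
  by rewrite lnM ?posrE ?exprn_gt0// lnXn// mulr_natl.
have lnl : n%:R * ln M + ln `|s - r| <= ln d.
  have : ln (M ^+ n * `|s - r|) <= ln d.
    by rewrite ler_ln ?posrE// mulr_gt0// exprn_gt0.
  by rewrite lnM ?posrE ?exprn_gt0// lnXn// mulr_natl.
have lne : ln `|s ^+ 2 - r ^+ 2| <= ln 2 + ln M + ln `|s - r|.
  have : ln `|s ^+ 2 - r ^+ 2| <= ln (2 * M * `|s - r|).
    by rewrite ler_ln ?posrE// !mulr_gt0.
  by rewrite !lnM ?posrE ?mulr_gt0.
rewrite M2 lnM2 [2^-1 * _]mulrA mulVf ?pnatr_eq0// mul1r.
have lerN (x : R) : - `|x| <= x by rewrite lerNl -normrN ler_norm.
have := ler_norm (ln `|s ^+ 2 - r ^+ 2|); have := lerN (ln `|s ^+ 2 - r ^+ 2|).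
have := ler_norm (2 * ln M); have := lerN (2 * ln M).
have := normr_ge0 (2 * ln M); have := normr_ge0 (ln `|s ^+ 2 - r ^+ 2|).
have l2 : 0 <= ln 2 :> R by rewrite ln_ge0// ler1n.
have nM : n.+1%:R * ln M = n%:R * ln M + ln M by rewrite -natr1 mulrDl mul1r.
rewrite ler_norml nM in lnu *.
move: (n%:R * ln M) lnu lnl => X lnu lnl.
move=> *; apply/andP; split; lra.
Qed.

End ComplexModulus.

Section DiskJensen.
Variable R : realType.
Notation leb := (@lebesgue_measure R).
Notation T := (measurableTypeR R).
Notation normc := ComplexField.Normc.normc.
Notation area := (@area R).
Notation sqn := (@sqn R).
Notation diskD := (@diskD R).

Definition measurable_complex (f : T * T -> R[i]) :=
  measurable_fun [set: T * T] (fun z => complex.Re (f z) : T) /\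
  measurable_fun [set: T * T] (fun z => complex.Im (f z) : T).

Lemma measurable_complex_cst w : measurable_complex (fun=> w).
Proof. by split; exact: measurable_cst. Qed.

Lemma measurable_complex_toC : measurable_complex (@toC R).
Proof. by split; [exact: measurable_fst|exact: measurable_snd]. Qed.

Lemma measurable_complexD f g : measurable_complex f -> measurable_complex g ->
  measurable_complex (fun z => f z + g z).
Proof.
move=> [f1 f2] [g1 g2]; split.
  rewrite (_ : (fun z => _) = (fun z => complex.Re (f z) + complex.Re (g z))).
    exact: measurable_funD.
  by apply/funext => z; rewrite raddfD.
rewrite (_ : (fun z => _) = (fun z => complex.Im (f z) + complex.Im (g z))).
  exact: measurable_funD.
by apply/funext => z; rewrite raddfD.
Qed.

Lemma measurable_complexM f g : measurable_complex f -> measurable_complex g ->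
  measurable_complex (fun z => f z * g z).
Proof.
move=> [f1 f2] [g1 g2]; split.
  rewrite (_ : (fun z => _) = (fun z => complex.Re (f z) * complex.Re (g z) -
      complex.Im (f z) * complex.Im (g z))).
    by apply: measurable_funB; exact: measurable_funM.
  by apply/funext => z; case: (f z) (g z) => [? ?] [? ?].
rewrite (_ : (fun z => _) = (fun z => complex.Re (f z) * complex.Im (g z) +
    complex.Im (f z) * complex.Re (g z))).
  by apply: measurable_funD; exact: measurable_funM.
by apply/funext => z; case: (f z) (g z) => [? ?] [? ?].
Qed.

Lemma measurable_complexX f n : measurable_complex f ->
  measurable_complex (fun z => f z ^+ n).
Proof.
move=> mf; elim: n => [|n IH]; first exact: measurable_complex_cst.
rewrite (_ : (fun z => _) = (fun z => f z * f z ^+ n)).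
  exact: measurable_complexM.
by apply/funext => z; rewrite exprS.
Qed.

Lemma measurable_ln_normc f : measurable_complex f ->
  measurable_fun [set: T * T] (fun z => ln (normc (f z)) : T).
Proof.
move=> [f1 f2]; apply: measurableT_comp; first exact: measurable_ln.
rewrite (_ : (fun z => _) =
    (fun z => Num.sqrt (complex.Re (f z) ^+ 2 + complex.Im (f z) ^+ 2))).
  apply: measurableT_comp.
    by apply: continuous_measurable_fun; exact: sqrt_continuous.
  by apply: measurable_funD; exact: measurable_funX.
by apply/funext => z; case: (f z).
Qed.

Lemma toC_rotation (e : R[i]) z :
  toC (rotation (complex.Re e) (complex.Im e) z) = e * toC z.
Proof.
case: e z => p q [x y]; rewrite /toC /rotation /=.
by apply/eqP; rewrite eq_complex /= [X in _ && (_ == X)]addrC !eqxx.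
Qed.

Section Offset.
Variables a b : R[i].
Hypotheses (a0 : a != 0) (b0 : b != 0).
Let A := normc a ^+ 2.
Let B := normc b ^+ 2.

Let A0 : 0 < A.
Proof. by rewrite exprn_gt0// lt_neqAle eq_sym normc_eq0 a0 normc_ge0. Qed.

Let B0 : 0 < B.
Proof. by rewrite exprn_gt0// lt_neqAle eq_sym normc_eq0 b0 normc_ge0. Qed.

(** The locus [|a x| = |b|], where the logarithm may meet its default value [ln 0 = 0] and
    [ln_normc_subX] does not apply. It is null and invariant under rotations, so it can be removed
    from the disc. *)
Let circle : set (T * T) := sqn @^-1` [set B / A].

Let mcircle : measurable circle.
Proof.
rewrite -[X in measurable X]setTI; exact: measurable_sqn.
Qed.

Let circle0 : area circle = 0%E.
Proof.
rewrite pushforward_sqn; last exact: measurable_set1.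
have m1 : measurable ([set B / A] : set T) by exact: measurable_set1.
rewrite (_ : leb _ = 0%E) ?mule0//; apply/eqP; rewrite -measure_le0.
rewrite -(lebesgue_measure_set1 (B / A)).
apply: le_measure; rewrite ?inE //.
by apply: measurableI => //; exact: measurable_itv.
Qed.

Let D : set (T * T) := diskD `\` circle.

Let mD : measurable D.
Proof. by apply: measurableD => //; exact: measurable_diskD. Qed.

Let notcircle z : D z -> normc (a * toC z) ^+ 2 != normc b ^+ 2.
Proof.
move=> [_]; rewrite ComplexField.Normc.normcM exprMn normc_toC => h.
apply: contra_notN h => /eqP E; rewrite /circle /=.
by rewrite /B -E -/A mulrAC divff ?mul1r// lt0r_neq0.
Qed.

Let mx z := 2^-1 * ln (Num.max (A * sqn z) B).
Let err z := ln 2 + `|ln `|A * sqn z - B| | + `|ln (Num.max (A * sqn z) B)|.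
Let f n z := ln (normc ((a * toC z) ^+ (2 ^ n) - b ^+ (2 ^ n))).

Let continuous_lnmax : continuous (fun t : R => ln (Num.max (A * t) B)).
Proof.
move=> t; apply: (@continuous_comp _ _ _ (fun t : R => Num.max (A * t) B) (@ln R)).
  apply: continuous_max; last exact: cst_continuous.
  by apply: cvgM; [exact: cvg_cst|exact: cvg_id].
by apply: continuous_ln; rewrite lt_max B0 orbT.
Qed.

Let lnmax_integrable :
  leb.-integrable `[0%R, 1%R] (EFin \o (fun t => ln (Num.max (A * t) B))).
Proof.
apply: continuous_compact_integrable; first exact: segment_compact.
exact: continuous_subspaceT.
Qed.

Let mlnmax : measurable_fun [set: T] (fun t : T => ln (Num.max (A * t) B) : T).
Proof. exact: continuous_measurable_fun. Qed.

Let lnmax_sqn_integrable :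
  area.-integrable diskD (fun z => (ln (Num.max (A * sqn z) B))%:E).
Proof. exact: (integrable_diskD_sqn mlnmax lnmax_integrable). Qed.

Let area_disk_fin : (area diskD < +oo)%E.
Proof.
rewrite diskD_sqn pushforward_sqn; last exact: measurable_itv.
apply: lte_mul_pinfty => //; first by rewrite lee_fin pi_ge0.
apply: (@le_lt_trans _ _ (leb `[0%R, 1%R])).
  by apply: le_measure; rewrite ?inE //=; apply: measurableI => //; exact: measurable_itv.
by rewrite lebesgue_measure_itv /= lte_fin ltr01 sube0 ltry.
Qed.

Let cst_integrable (c : R) : area.-integrable diskD (fun=> c%:E).
Proof.
apply/integrableP; split; first exact: measurable_cst.
rewrite integral_cst; last exact: measurable_diskD.
by apply: lte_mul_pinfty.
Qed.

Let err_integrable : area.-integrable diskD (EFin \o err).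
Proof.
have mDD := @measurable_diskD R.
have mab : measurable_fun [set: T] (fun t : T => ln `|A * t - B| : T).
  apply: measurableT_comp; first exact: measurable_ln.
  by apply: measurableT_comp => //; apply: measurable_funB => //; exact: measurable_funM.
have i1 := integrable_diskD_sqn mab (integrable_ln_affine B A0).
have i2 := integrableD mDD (cst_integrable (ln 2)) (integrable_norm i1).
have i3 := integrableD mDD i2 (integrable_norm
  (lnmax_sqn_integrable : area.-integrable diskD (EFin \o (fun z => ln (Num.max (A * sqn z) B))))).
by apply: eq_integrable i3.
Qed.

Let mx_integrable : area.-integrable diskD (EFin \o mx).
Proof. have mDD := @measurable_diskD R.
have := integrableZl mDD 2^-1 lnmax_sqn_integrable.
by apply: eq_integrable. Qed.

Let sub_integrable (g : T * T -> R) : area.-integrable diskD (EFin \o g) ->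
  area.-integrable D (EFin \o g).
Proof.
by apply: integrableS => //; [exact: measurable_diskD|exact: subDsetl].
Qed.

(** The bound depends on moduli only, so the same [err] serves at the rotated point [e * toC z].
    This makes the rotated integrand integrable, as the change of variables requires. *)
Let f_bound (e : R[i]) n z : D z -> normc e = 1 ->
  `|ln (normc ((a * (e * toC z)) ^+ (2 ^ n) - b ^+ (2 ^ n))) - (2 ^ n)%:R * mx z|
    <= err z.
Proof.
move=> Dz e1; have := notcircle Dz.
have -> : normc (a * toC z) = normc (a * (e * toC z)).
  by rewrite !ComplexField.Normc.normcM e1 mul1r.
have [k ->] : exists k, (2 ^ n = k.+1)%N by exists (2 ^ n).-1; rewrite prednK// expn_gt0.
move=> h; have := ln_normc_subX k b0 h.
have -> : normc (a * (e * toC z)) ^+ 2 = A * sqn z.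
  by rewrite !ComplexField.Normc.normcM e1 mul1r exprMn normc_toC.
by [].
Qed.

Let measurable_f (e : R[i]) n : measurable_fun [set: T * T]
  (fun z => ln (normc ((a * (e * toC z)) ^+ (2 ^ n) - b ^+ (2 ^ n))) : T).
Proof.
apply: measurable_ln_normc.
apply: measurable_complexD; last exact: measurable_complex_cst.
apply: measurable_complexX; apply: measurable_complexM.
  exact: measurable_complex_cst.
apply: measurable_complexM; first exact: measurable_complex_cst.
exact: measurable_complex_toC.
Qed.

Let fe_integrable (e : R[i]) n : normc e = 1 -> area.-integrable D
  (EFin \o (fun z => ln (normc ((a * (e * toC z)) ^+ (2 ^ n) - b ^+ (2 ^ n))))).
Proof.
move=> e1.
have ig : area.-integrable D (EFin \o (fun z => err z + (2 ^ n)%:R * `|mx z|)).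
  have := integrableD mD (sub_integrable err_integrable)
    (integrableZl mD (2 ^ n)%:R (integrable_norm (sub_integrable mx_integrable))).
  by apply: eq_integrable.
apply: le_integrable ig => //.
  by apply/measurable_EFinP; apply: measurable_funTS; exact: measurable_f.
move=> z Dz /=; rewrite lee_fin; apply: (le_trans _ (ler_norm _)).
rewrite -[X in `|X|](subrK ((2 ^ n)%:R * mx z)).
apply: le_trans (ler_normD _ _) _; rewrite normrM normr_nat lerD2r.
exact: f_bound.
Qed.

Let f_integrable n : area.-integrable D (EFin \o f n).
Proof.
have := @fe_integrable 1 n (ComplexField.Normc.normc1 R).
by under eq_fun do rewrite mul1r.
Qed.

Let f_rotate (e : R[i]) n : normc e = 1 ->
  \int[area]_(z in D) ln (normc ((a * (e * toC z)) ^+ (2 ^ n) - b ^+ (2 ^ n))) =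
  \int[area]_(z in D) f n z.
Proof.
move=> e1; pose r := rotation (complex.Re e) (complex.Im e).
have pq : complex.Re e ^+ 2 + complex.Im e ^+ 2 = 1.
  by rewrite -sqr_normcE e1 expr1n.
have rD : r @^-1` D = D.
  have sr z : sqn (r z) = sqn z.
    by rewrite -!normc_toC toC_rotation ComplexField.Normc.normcM e1 mul1r.
  by rewrite /D diskD_sqn; apply/seteqP; split => z; rewrite /circle /= sr.
have mf : measurable_fun [set: T * T] (fun z => (f n z)%:E).
  apply/measurable_EFinP; have := @measurable_f 1 n.
  by under eq_fun do rewrite mul1r.
have ir : area.-integrable (r @^-1` D) ((fun z => (f n z)%:E) \o r).
  rewrite rD; apply: eq_integrable (fe_integrable n e1) => // z _ /=.
  by rewrite /f toC_rotation.
have E : (\int[area]_(z in r @^-1` D) (f n (r z))%:E =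
    \int[area]_(z in D) (f n z)%:E)%E.
  exact: (integral_area_preserving (area_preserving_rotation pq) mD mf ir).
rewrite rD in E; apply: (congr1 fine); refine (etrans _ E).
by apply: eq_integral => z _; rewrite /f toC_rotation.
Qed.

(* [u ^ (2 N) - v ^ (2 N) = (u ^ N - v ^ N) (u ^ N + v ^ N)], and the second factor is the
   first one at a rotated point since [-1] has an [N]-th root on the unit circle. *)
Let f_double n : \int[area]_(z in D) f n.+1 z = 2 * \int[area]_(z in D) f n z.
Proof.
(* Obtained by taking [n] successive square roots, starting from [-1]. *)
have [e eN] : exists e : R[i], e ^+ (2 ^ n) = -1.
  elim: n => [|n [e IH]]; first by exists (-1).
  by exists (sqrtc e); rewrite expnS exprM sqr_sqrtc.
have e1 : normc e = 1.
  have : normc e ^+ (2 ^ n) = 1.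
    by rewrite -normcX eN normcN ComplexField.Normc.normc1.
  by move/eqP; rewrite pexpr_eq1 ?expn_gt0 ?normc_ge0// => /eqP.
rewrite mulrDl !mul1r -{2}(f_rotate n e1) -RintegralD//; last exact: fe_integrable.
apply: eq_Rintegral => z; rewrite inE => /notcircle Dz.
pose u := (a * toC z) ^+ (2 ^ n); pose v := b ^+ (2 ^ n).
(* Off the circle neither factor vanishes, so the logarithm of the product splits in spite of
   [ln 0 = 0]. *)
have uv : normc (u ^+ 2 - v ^+ 2) != 0.
  rewrite normc_eq0 subr_eq0; apply: contra Dz => /eqP E.
  rewrite -(@eqrXn2 _ (2 ^ n)) ?expn_gt0 ?exprn_ge0 ?normc_ge0//.
  by rewrite -!normcX -!exprM mulnC !exprM -/u -/v E.
have -> : f n.+1 z = ln (normc (u ^+ 2 - v ^+ 2)).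
  by rewrite /f expnS mulnC !exprM.
move: uv; rewrite subr_sqr ComplexField.Normc.normcM mulf_eq0 negb_or => /andP[uv1 uv2].
rewrite lnM ?posrE ?lt_neqAle ?(eq_sym 0) ?uv1 ?uv2 ?normc_ge0//.
have -> : (a * (e * toC z)) ^+ (2 ^ n) = - u by rewrite mulrCA exprMn eN mulN1r.
by rewrite -opprD normcN.
Qed.

Let jensen_D : \int[area]_(z in D) f 0 z = \int[area]_(z in D) mx z.
Proof.
have fE n : \int[area]_(z in D) f n z = 2 ^+ n * \int[area]_(z in D) f 0 z.
  by elim: n => [|n IH]; rewrite ?expr0 ?mul1r// f_double IH mulrA exprS.
have H n : 2 ^+ n * `|\int[area]_(z in D) f 0 z - \int[area]_(z in D) mx z| <=
    \int[area]_(z in D) err z.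
  have imx := sub_integrable mx_integrable.
  have imxn : area.-integrable D (EFin \o (fun z => 2 ^+ n * mx z)).
    have := integrableZl mD (2 ^+ n) imx.
    by apply: eq_integrable.
  have id : area.-integrable D (EFin \o (fun z => f n z - 2 ^+ n * mx z)).
    have := integrableB mD (f_integrable n) imxn.
    by apply: eq_integrable.
  rewrite -[X in X * _](@ger0_norm _ (2 ^+ n)) ?exprn_ge0// -normrM mulrBr -fE.
  rewrite -RintegralZl// -RintegralB//.
  apply: le_trans (le_normr_Rintegral mD id) _.
  apply: le_Rintegral => //; [exact: integrable_norm|exact: sub_integrable|].
  move=> z Dz; have := @f_bound 1 n z Dz (ComplexField.Normc.normc1 R).
  by rewrite mul1r natrX.
(* A nonnegative number whose multiples by all [2 ^ n] stay below one bound is zero; [k < 2 ^ k]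
   gives the contradiction with the Archimedean property. *)
apply/eqP; rewrite -subr_eq0 -normr_eq0; apply: contraT => d0.
have {}d0 : 0 < `|\int[area]_(z in D) f 0 z - \int[area]_(z in D) mx z|.
  by rewrite lt_neqAle eq_sym d0 normr_ge0.
move: H d0; move: `|_| (\int[area]_(z in D) err z) => d E H d0.
have := archi_boundP (normr_ge0 (E / d)); set k := Num.bound _ => Ek.
have := H k; rewrite leNgt => /negP[].
rewrite -ltr_pdivrMr//; apply: le_lt_trans (ler_norm _) _; apply: lt_trans Ek _.
by rewrite -natrX ltr_nat ltn_expl.
Qed.

Lemma jensen_disk_neq0 :
  (\int[area]_(z in diskD) (ln (normc (a * toC z - b)))%:E =
   \int[area]_(z in diskD) (2^-1 * ln (Num.max (normc a ^+ 2 * sqn z) (normc b ^+ 2)))%:E)%E.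
Proof.
have mDD := @measurable_diskD R.
have mf : measurable_fun diskD (fun z => (ln (normc (a * toC z - b)))%:E).
  apply/measurable_EFinP; apply: measurable_funTS; have := @measurable_f 1 0.
  by under eq_fun do rewrite mul1r expn0 !expr1.
have If : area.-integrable diskD (fun z => (ln (normc (a * toC z - b)))%:E).
  apply/(negligible_integrable mcircle mDD mf circle0).
  by apply: eq_integrable (f_integrable 0).
rewrite (negligible_integral mcircle mDD If circle0).
rewrite (negligible_integral mcircle mDD mx_integrable circle0).
rewrite -[LHS]fineK; last first.
  by apply: integrable_fin_num => //; apply: integrableS If => //; exact: subDsetl.
rewrite -[RHS]fineK; last first.
  by apply: integrable_fin_num => //; exact: sub_integrable mx_integrable.
by congr (_%:E); exact: jensen_D.
Qed.

End Offset.
End DiskJensen.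

(** * One-dimensional averages *)

Section RadialAverages.
Variable R : realType.
Notation leb := (@lebesgue_measure R).
Notation T := (measurableTypeR R).

Definition exp_partial (k : nat) (L : R) : R := \sum_(i < k) L ^+ i / i`!%:R.

(* [E (ln (X / c))^+] at [L = - ln c], for a product [X] of [k] independent uniform
   variables on [[0, 1]]. *)
Definition excess (k : nat) (L : R) : R :=
  L - k%:R + expR (- L) * \sum_(j < k) exp_partial j.+1 L.

Lemma exp_partialS k L :
  exp_partial k.+1 L = exp_partial k L + L ^+ k / k`!%:R.
Proof. by rewrite /exp_partial big_ord_recr. Qed.

Lemma is_derive_mul (f g : R -> R) (x df dg : R) :
  is_derive x 1 f df -> is_derive x 1 g dg ->
  is_derive x 1 (fun t => f t * g t) (f x * dg + df * g x).
Proof.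
by move=> hf hg; apply: is_derive_eq (is_deriveM hf hg) _; rewrite (mulrC df).
Qed.

Lemma is_derive_exprn n (x : R) :
  is_derive x 1 (fun t : R => t ^+ n.+1) (n.+1%:R * x ^+ n).
Proof.
by apply: DeriveDef; [exact: exprn_derivable|rewrite exp_derive /GRing.scale /= mulr1].
Qed.

Lemma divr_factS n : n.+1%:R / (n.+1)`!%:R = n`!%:R^-1 :> R.
Proof. by rewrite factS natrM invfM mulrA mulfV ?mul1r// pnatr_eq0. Qed.

Lemma is_derive_exp_partial k (L : R) :
  is_derive L 1 (exp_partial k.+1) (exp_partial k L).
Proof.
elim: k => [|k IH].
  rewrite (_ : exp_partial 1 = cst 1).
    by rewrite /exp_partial big_ord0; exact: is_derive_cst.
  by apply/funext => x; rewrite /exp_partial big_ord1 expr0 fact0 divr1.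
have d : is_derive L 1 (fun x : R => x ^+ k.+1 * (k.+1)`!%:R^-1) (L ^+ k / k`!%:R).
  apply: is_derive_eq (is_derive_mul (is_derive_exprn k L) (is_derive_cst _ L 1)) _.
  by rewrite mulr0 add0r mulrAC divr_factS mulrC.
rewrite exp_partialS (_ : exp_partial k.+2 =
    exp_partial k.+1 + (fun x => x ^+ k.+1 / (k.+1)`!%:R)).
  exact: is_deriveD.
by apply/funext => x; rewrite exp_partialS.
Qed.

(** In the coordinate [L = ln r], the average [u] of [f (r * t)] over [t] in [[0, 1]] satisfies
    [u + u' = f]. Here [f] is [excess k] and [u] is [excess k.+1]; [excess0] fixes the initial
    value. *)
Lemma is_derive_excess k (L : R) :
  is_derive L 1 (excess k.+1) (excess k L - excess k.+1 L).
Proof.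
have dS : is_derive L 1 (fun x => \sum_(j < k.+1) exp_partial j.+1 x)
    (\sum_(j < k) exp_partial j.+1 L).
  elim: k => [|k IH].
    rewrite big_ord0 (_ : (fun x => _) = exp_partial 1); last first.
      by apply/funext => x; rewrite big_ord1.
    by apply: is_derive_eq (is_derive_exp_partial 0 L) _; rewrite /exp_partial big_ord0.
  rewrite (_ : (fun x => _) = (fun x => \sum_(j < k.+1) exp_partial j.+1 x) +
      exp_partial k.+2); last first.
    by apply/funext => x; rewrite big_ord_recr.
  by rewrite big_ord_recr /=; apply: is_deriveD; exact: is_derive_exp_partial.
have dE : is_derive L 1 (fun x : R => expR (- x)) (- expR (- L)).
  apply: is_derive_eq (is_derive1_comp (is_derive_expR _) (is_deriveNid _ _)) _.
  by rewrite mulrN1.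
have dL : is_derive L 1 (fun x : R => x - k.+1%:R) (1 - 0) by exact: is_deriveB.
apply: is_derive_eq (is_deriveD dL (is_derive_mul dE dS)) _.
rewrite /excess; set S := \sum_(j < k.+1) _; set S' := \sum_(j < k) _.
by rewrite -natr1; ring.
Qed.

Lemma excess0 k : excess k 0 = 0.
Proof.
rewrite /excess oppr0 expR0 mul1r sub0r (eq_bigr (fun=> 1)).
  by rewrite sumr_const card_ord addNr.
move=> j _; rewrite /exp_partial big_ord_recl expr0 fact0 divr1 big1 ?addr0// => i _.
by rewrite /= expr0n mul0r.
Qed.

Lemma continuous_excess k : continuous (excess k).
Proof.
case: k => [|k] L.
  rewrite (_ : excess 0 = id); first exact: cvg_id.
  by apply/funext => x; rewrite /excess big_ord0 mulr0 addr0 subr0.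
apply: differentiable_continuous; apply/derivable1_diffP.
by have := is_derive_excess k L; case.
Qed.

Lemma continuous_excess_ln k (r : R) :
  continuous (fun t => excess k (ln (Num.max 1 (r * t)))).
Proof.
move=> t; apply: (@continuous_comp _ _ _ (fun t => ln (Num.max 1 (r * t)))).
  apply: (@continuous_comp _ _ _ (fun t => Num.max 1 (r * t))).
    apply: continuous_max; first exact: cst_continuous.
    by apply: cvgM; [exact: cvg_cst|exact: cvg_id].
  by apply: continuous_ln; rewrite lt_max ltr01.
exact: continuous_excess.
Qed.

Lemma integral_excess k (r : R) : 0 <= r ->
  (\int[leb]_(t in `[0%R, 1%R]) (excess k (ln (Num.max 1 (r * t))))%:E =
   (excess k.+1 (ln (Num.max 1 r)))%:E)%E.
Proof.
move=> r0; have [r1|r1] := leP r 1.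
  rewrite ln1 excess0 integral0_eq// => t /=; rewrite in_itv /= => /andP[t0 t1].
  by rewrite max_l ?ln1 ?excess0// mulr_ile1.
have rp : 0 < r by apply: lt_trans r1.
have r'1 : r^-1 < 1 by rewrite invf_lt1.
have r'0 : 0 < r^-1 by rewrite invr_gt0.
(* By [u + u' = f] in the logarithmic coordinate, this is an antiderivative on [[r^-1, 1]]; below
   [r^-1] the maximum is 1 and the integrand vanishes. *)
pose F t := t * excess k.+1 (ln (r * t)).
have dF t : t \in `[r^-1, 1]%R -> is_derive t 1 F (excess k (ln (Num.max 1 (r * t)))).
  rewrite in_itv /= => /andP[rt t1].
  have t0 : 0 < t by apply: lt_le_trans rt.
  have rt1 : 1 <= r * t by rewrite mulrC -ler_pdivrMr// mul1r.
  have dln : is_derive t 1 (fun t => ln (r * t)) t^-1.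
    have d1 : is_derive (r * t) 1 (@ln R) (r * t)^-1 by apply: is_derive1_ln; rewrite mulr_gt0.
    have d2 := is_deriveZ r (is_derive_id t (1 : R)).
    apply: is_derive_eq (is_derive1_comp d1 d2) _.
    by rewrite /GRing.scale /= mulr1 invfM mulrAC mulVf ?mul1r// lt0r_neq0.
  have dg := @is_derive1_comp _ _ (fun t => ln (r * t)) t _ _
    (is_derive_excess k (ln (r * t))) dln.
  apply: is_derive_eq (is_derive_mul (is_derive_id t 1) dg) _.
  rewrite /= (max_r rt1) mulrCA mulfV ?lt0r_neq0// mulr1 mul1r subrK.
  by [].
have ci : leb.-integrable `[0%R, 1%R] (EFin \o (fun t => excess k (ln (Num.max 1 (r * t))))).
  apply: continuous_compact_integrable; first exact: segment_compact.
  exact/continuous_subspaceT/continuous_excess_ln.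
have m01 : measurable (`[0%R, 1%R]%classic : set T) by exact: measurable_itv.
have split01 : `[0%R, 1%R]%classic = `[0%R, r^-1[ `|` `[r^-1, 1%R] :> set R.
  by rewrite -itv_bndbnd_setU// bnd_simp ltW.
rewrite split01 integral_setU//=; last 2 first.
- apply/measurable_EFinP; apply: measurable_funTS.
  by apply: continuous_measurable_fun; exact: continuous_excess_ln.
- by apply/disj_setPRL => t /=; rewrite !in_itv /= => /andP[rt _] /andP[_]; rewrite ltNge rt.
rewrite integral0_eq ?add0e; last first.
  move=> t /=; rewrite in_itv /= => /andP[t0 tr].
  by rewrite max_l ?ln1 ?excess0// mulrC -ler_pdivlMr// div1r ltW.
rewrite (FTC2_is_derive r'1 dF).
  by rewrite /F divff ?lt0r_neq0// ln1 excess0 mulr0 subr0 mul1r mulr1.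
exact/continuous_subspaceT/continuous_excess_ln.
Qed.

(** The Poisson weight [exp (- L) * L ^ i / i!] at [L = - ln x]; [excess] expands into these
    weights. *)
Definition log_moment (i : nat) (x : R) : R := x * ((- ln x) ^+ i / i`!%:R).

(* The [n]-fold iterate of the average [f |-> (x |-> \int_0^1 f (x t) dt)], applied to
   [log_moment i]. *)
Fixpoint log_avg (n : nat) : nat -> R -> R :=
  if n is n'.+1 then
    fix avg (i : nat) (x : R) : R :=
      if i is i'.+1 then 2^-1 * (log_avg n' i x + avg i' x)
      else 2^-1 * log_avg n' 0%N x
  else log_moment.

Lemma log_avg0S n x : log_avg n.+1 0 x = 2^-1 * log_avg n 0 x.
Proof. by []. Qed.

(** With [D = x d/dx], [D (log_moment i.+1) = log_moment i.+1 - log_moment i], and averaging inverts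
    [1 + D]. Solving for the average of [log_moment i.+1] yields this recursion at [n = 0]; further
    averages inherit it by linearity. *)
Lemma log_avgSS n i x :
  log_avg n.+1 i.+1 x = 2^-1 * (log_avg n i.+1 x + log_avg n.+1 i x).
Proof. by []. Qed.

Lemma log_avg_at0 n i : log_avg n i 0 = 0.
Proof.
elim: n i => [|n IHn] i; first by rewrite /= /log_moment mul0r.
elim: i => [|i IHi]; first by rewrite log_avg0S IHn mulr0.
by rewrite log_avgSS IHn IHi addr0 mulr0.
Qed.

(** This is the mean of a Poisson weight at a Gamma variable of shape [n + 1]. The recursion of
    [log_avg] is Pascal's rule [nbinS], and at 1 only [log_moment 0] is nonzero. *)
Lemma log_avg_at1 n i : log_avg n.+1 i 1 = nbin R n i.
Proof.
have m0 j : log_moment j 1 = (j == 0)%N%:R.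
  rewrite /log_moment ln1 oppr0 expr0n mul1r.
  by case: j => [|j]; rewrite ?fact0 ?divr1// mul0r.
have b0 j : nbin R 0 j = 2^-1 ^+ j.+1 by exact: nbin0.
have bS j k : nbin R j.+1 k.+1 = 2^-1 * (nbin R j k.+1 + nbin R j.+1 k).
  exact: nbinS.
elim: n i => [|n IHn]; elim=> [|i IHi].
- by rewrite b0 expr1 log_avg0S /= m0 eqxx mulr1.
- by rewrite log_avgSS IHi /= m0 add0r !b0 -exprS.
- by rewrite log_avg0S IHn nbinC b0 -exprS nbinC b0.
- by rewrite log_avgSS IHn IHi bS.
Qed.

Lemma is_derive_lnX i (x : R) : 0 < x ->
  is_derive x 1 (fun t => (- ln t) ^+ i.+1 / (i.+1)`!%:R)
    (- ((- ln x) ^+ i / i`!%:R) / x).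
Proof.
move=> x0; have dln := is_deriveN (is_derive1_ln x0).
have d1 : is_derive x 1 (fun t : R => (- ln t) ^+ i.+1)
    (i.+1%:R * (- ln x) ^+ i * - x^-1).
  exact: (@is_derive1_comp _ _ (- @ln R) x _ _ (is_derive_exprn i (- ln x)) dln).
have d2 : is_derive x 1 (fun _ : R => (i.+1)`!%:R^-1 : R) 0 by exact: is_derive_cst.
apply: is_derive_eq (is_derive_mul d1 d2) _.
by rewrite mulr0 add0r -(divr_factS i) !mulrN !mulNr; congr (- _); ring.
Qed.

Lemma is_derive_log_moment0 (x : R) : is_derive x 1 (log_moment 0) 1.
Proof.
rewrite (_ : log_moment 0 = id); first exact: is_derive_id.
by apply/funext => t; rewrite /log_moment expr0 fact0 divr1 mulr1.
Qed.

Lemma is_derive_log_momentS i (x : R) : 0 < x ->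
  is_derive x 1 (log_moment i.+1) ((log_moment i.+1 x - log_moment i x) / x).
Proof.
move=> x0; apply: is_derive_eq (is_derive_mul (is_derive_id x 1) (is_derive_lnX i x0)) _.
rewrite /log_moment -mulrBr mulrAC mulfV ?lt0r_neq0// mul1r mul1r addrC.
by rewrite mulrCA mulfV ?lt0r_neq0// mulr1.
Qed.

(* [log_avg 1 i] is the solution of [u + x u' = log_moment i]. *)
Lemma is_derive_log_avg1 i (x : R) : 0 < x ->
  is_derive x 1 (log_avg 1 i) ((log_moment i x - log_avg 1 i x) / x).
Proof.
move=> x0; elim: i => [|i IH].
  apply: is_derive_eq (is_deriveZ 2^-1 (is_derive_log_moment0 x)) _.
  rewrite log_avg0S /= /log_moment expr0 fact0 divr1 mulr1 /GRing.scale /= mulr1.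
  by field; exact: lt0r_neq0.
apply: is_derive_eq (is_deriveZ 2^-1 (is_deriveD (is_derive_log_momentS i x0) IH)) _.
have -> : log_avg 1 i.+1 x = 2^-1 * (log_moment i.+1 x + log_avg 1 i x) by [].
move: (log_moment i.+1 x) (log_moment i x) (log_avg 1 i x) => u v w.
rewrite /GRing.scale /=.
by field; exact: lt0r_neq0.
Qed.

(** Serves for continuity at the origin. For a positive exponent [k], put [s = sqrt x] and
    [y = - ln s / k]: raising [y <= exp y] to the power [k] gives [s * y ^ k <= 1], and the constant
    comes from [- ln x = 2 * k * y]. *)
Lemma log_moment_bound i : exists C : R,
  0 <= C /\ forall x : R, `|x| <= 1 -> `|log_moment i x| <= C * Num.sqrt `|x|.
Proof.
have sqrtle (x : R) : `|x| <= 1 -> `|x| <= Num.sqrt `|x|.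
  move=> x1; rewrite -[leLHS]sqr_sqrtr// expr2 ler_piMl ?sqrtr_ge0//.
  by rewrite -[leRHS]sqrtr1 ler_sqrt.
have f0 : 0 < i`!%:R :> R by rewrite ltr0n fact_gt0.
case: i f0 => [|i] f0.
  exists 1; split => // x x1.
  by rewrite mul1r /log_moment expr0 fact0 divr1 mulr1 sqrtle.
pose c : R := (2 * i.+1%:R) ^+ i.+1; have c0 : 0 <= c by rewrite exprn_ge0// mulr_ge0.
exists (c / (i.+1)`!%:R); split; first by rewrite divr_ge0// ltW.
move=> x x1; rewrite /log_moment normrM.
have [x0|x0] := leP x 0.
  rewrite ln0// oppr0 expr0n mul0r normr0 mulr0.
  by rewrite mulr_ge0 ?sqrtr_ge0// divr_ge0// ltW.
have lnx : 0 <= - ln x by rewrite oppr_ge0 ln_le0// -(gtr0_norm x0).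
rewrite (gtr0_norm x0) ger0_norm; last by rewrite divr_ge0 ?exprn_ge0// ltW.
rewrite mulrA [leRHS]mulrAC ler_pM2r ?invr_gt0//.
pose s := Num.sqrt x; have s0 : 0 < s by rewrite sqrtr_gt0.
rewrite -/s; have -> : x = s ^+ 2 by rewrite sqr_sqrtr// ltW.
rewrite lnXn// expr2 [leRHS]mulrC -mulrA ler_pM2l//.
have -> : s * (- (ln s *+ 2)) ^+ i.+1 = c * (s * (- ln s / i.+1%:R) ^+ i.+1).
  rewrite mulrCA; congr (_ * _); rewrite -exprMn; congr (_ ^+ _).
  rewrite -(mulr_natl (ln s)) -[RHS]mulrA (mulrCA i.+1%:R).
  by rewrite mulfV ?pnatr_eq0// mulr1 mulrN.
rewrite ler_piMr//.
have h : - ln s / i.+1%:R <= expR (- ln s / i.+1%:R).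
  by apply: le_trans (expR_ge1Dx _); rewrite lerDr.
apply: (@le_trans _ _ (s * expR (- ln s / i.+1%:R) ^+ i.+1)).
  rewrite ler_pM2l//; apply: lerXn2r => //; rewrite nnegrE ?expR_ge0//.
  rewrite divr_ge0// oppr_ge0 ln_le0// /s -[leRHS]sqrtr1 ler_sqrt//.
  by rewrite -(gtr0_norm x0).
rewrite -expRM_natl mulrCA mulfV ?pnatr_eq0// mulr1 expRN lnK ?posrE//.
by rewrite mulfV// lt0r_neq0.
Qed.

Lemma continuous_log_moment i (x : R) : 0 <= x -> {for x, continuous (log_moment i)}.
Proof.
rewrite le_eqVlt => /predU1P[<-|x0]; last first.
  apply: differentiable_continuous; apply/derivable1_diffP.
  case: i => [|i]; first by have := is_derive_log_moment0 x; case.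
  by have := is_derive_log_momentS i x0; case.
have [C [C0 HC]] := log_moment_bound i.
have sq0 : (fun t : R => C * Num.sqrt `|t|) t @[t --> 0] --> C * Num.sqrt `|0 : R|.
  apply: cvgM; first exact: cvg_cst.
  apply: (@continuous_comp _ _ _ (fun t : R => `|t|) (@Num.sqrt R)).
    exact: norm_continuous.
  exact: sqrt_continuous.
rewrite normr0 sqrtr0 mulr0 in sq0.
have f0 : log_moment i 0 = 0 by rewrite /log_moment mul0r.
suff h : log_moment i t @[t --> (0 : R)] --> (0 : R).
  by change (log_moment i t @[t --> (0 : R)] --> log_moment i 0); rewrite f0.
apply/cvgr0Pnorm_le => e e0.
move/cvgr0Pnorm_le : sq0 => /(_ e e0) sq0.
near=> t; apply: le_trans (HC t _) _.
  by near: t; have /cvgr0Pnorm_le := (@cvg_id R (nbhs (0 : R))); apply.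
apply: le_trans (ler_norm _) _; near: t; exact: sq0.
Unshelve. all: by end_near. Qed.

Lemma continuous_log_avg n i (x : R) : 0 <= x -> {for x, continuous (log_avg n i)}.
Proof.
move=> x0; elim: n i => [|n IHn] i; first exact: continuous_log_moment.
elim: i => [|i IHi]; first by apply: cvgM; [exact: cvg_cst|exact: IHn].
apply: cvgM; first exact: cvg_cst.
by apply: cvgD; [exact: IHn|exact: IHi].
Qed.

Lemma measurable_log_avg n i : measurable_fun [set: T] (log_avg n i : T -> T).
Proof.
elim: n i => [|n IHn] i.
  apply: measurable_funM => //; apply: measurable_funM => //.
  by apply: measurable_funX; apply: measurableT_comp => //; exact: measurable_ln.
elim: i => [|i IHi]; first by apply: measurable_funM; [|exact: IHn].
by apply: measurable_funM => //; apply: measurable_funD; [exact: IHn|exact: IHi].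
Qed.

Lemma within_continuous_log_avg n i (B : R) : 0 <= B ->
  {within `[0%R, 1%R], continuous (fun t => log_avg n i (B * t))}.
Proof.
move=> B0; apply: continuous_in_subspaceT => t; rewrite inE /= in_itv /= => /andP[t0 _].
apply: (@continuous_comp _ _ _ (fun t => B * t)).
  by apply: cvgM; [exact: cvg_cst|exact: cvg_id].
by apply: continuous_log_avg; rewrite mulr_ge0.
Qed.

Lemma integrable_log_avg n i (B : R) : 0 <= B ->
  leb.-integrable `[0%R, 1%R] (EFin \o (fun t => log_avg n i (B * t))).
Proof.
move=> B0; apply: continuous_compact_integrable; first exact: segment_compact.
exact: within_continuous_log_avg.
Qed.

Lemma integral_log_moment i (B : R) : 0 <= B ->
  (\int[leb]_(t in `[0%R, 1%R]) (log_moment i (B * t))%:E = (log_avg 1 i B)%:E)%E.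
Proof.
rewrite le_eqVlt => /predU1P[<-|B0].
  rewrite integral0_eq; first by rewrite log_avg_at0.
  by move=> t _; rewrite mul0r /log_moment mul0r.
pose F t := t * log_avg 1 i (B * t).
have cF (t : R) : 0 <= t -> {for t, continuous F}.
  move=> t0; apply: cvgM; first exact: cvg_id.
  apply: (@continuous_comp _ _ _ (fun t => B * t)).
    by apply: cvgM; [exact: cvg_cst|exact: cvg_id].
  by apply: continuous_log_avg; rewrite mulr_ge0// ltW.
have dF (t : R) : 0 < t -> is_derive t 1 F (log_moment i (B * t)).
  move=> t0; have Bt0 : 0 < B * t by rewrite mulr_gt0.
  have dB := is_deriveZ B (is_derive_id t (1 : R)).
  have du := @is_derive1_comp _ _ (fun t => B * t) t _ _ (is_derive_log_avg1 i Bt0) dB.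
  apply: is_derive_eq (is_derive_mul (is_derive_id t 1) du) _.
  rewrite [B *: _]mulr1; set u := log_avg 1 i (B * t); set v := log_moment _ _.
  have -> : id t * ((v - u) / (B * t) * B) = v - u.
    by rewrite invfM; field; apply/andP; split; exact: lt0r_neq0.
  by rewrite mul1r subrK.
(* The derivative is known for [t > 0] only; at the endpoint 0 continuity takes its place. *)
rewrite (continuous_FTC2 (F := F) ltr01).
- by rewrite /F mul0r sube0 mul1r mulr1.
- exact: (@within_continuous_log_avg 0 i B (ltW B0)).
- split.
  + by move=> t; rewrite in_itv /= => /andP[t0 _]; have := dF t t0; case.
  + by apply: cvg_at_right_filter; exact: cF.
  + by apply: cvg_at_left_filter; exact: cF.
- move=> t; rewrite in_itv /= => /andP[t0 _].
  by rewrite derive1E; have := dF t t0 => ?; rewrite derive_val.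
Qed.

(** Only [n = 0] needs calculus: the recursion of [log_avg] is linear with coefficients independent
    of [n], so averaging raises [n] in every term. *)
Lemma integral_log_avg n i (B : R) : 0 <= B ->
  (\int[leb]_(t in `[0%R, 1%R]) (log_avg n i (B * t))%:E = (log_avg n.+1 i B)%:E)%E.
Proof.
move=> B0; have m01 : measurable (`[0%R, 1%R]%classic : set T) by exact: measurable_itv.
elim: n i => [|n IHn] i; first exact: integral_log_moment.
elim: i => [|i IHi].
  rewrite (eq_integral (fun t : T => 2^-1%:E * (log_avg n 0 (B * t))%:E)%E) //.
  by rewrite integralZl//; [rewrite IHn -EFinM|exact: integrable_log_avg].
rewrite (eq_integral (fun t : T => 2^-1%:E *
  ((log_avg n i.+1 (B * t))%:E + (log_avg n.+1 i (B * t))%:E))%E) //.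
have i1 := integrable_log_avg n i.+1 B0; have i2 := integrable_log_avg n.+1 i B0.
rewrite integralZl//; last exact: integrableD.
by rewrite integralD// IHn IHi -EFinD -EFinM.
Qed.

End RadialAverages.

(** * Iterated integrals *)

Section AreaIntegral.
Variable R : realType.
Notation T := (measurableTypeR R).
Import HBNNSimple.

(* [iter_disk_int] integrates over the default measurable structure on [R * R], which has
   the same measurable sets as [T * T] but another display, hence another type of simple
   functions. *)
Lemma nnsfun_display (g : R * R -> \bar R) :
  [set sintegral (@areaC R) h | h in [set h : {nnsfun (R * R)%type >-> R} |
    forall x, ((h x)%:E <= g x)%E]] =
  [set sintegral (@area R) h | h in [set h : {nnsfun (T * T)%type >-> R} |
    forall x, ((h x)%:E <= g x)%E]].
Proof.
apply/seteqP; split => _ [h hg <-].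
  have mh : measurable_fun [set: T * T] (h : T * T -> R) := measurable_funPT h.
  pose h' : {nnsfun (T * T)%type >-> R} := HB.pack (h : T * T -> R)
    (isMeasurableFun.Build _ _ _ _ _ mh) (FiniteImage.Build _ _ _ (@fimfunP _ _ h))
    (isNonNegFun.Build _ _ _ (@fun_ge0 _ _ h)).
  by exists h'.
have mh : measurable_fun [set: R * R] (h : R * R -> R) := measurable_funPT h.
pose h' : {nnsfun (R * R)%type >-> R} := HB.pack (h : R * R -> R)
  (isMeasurableFun.Build _ _ _ _ _ mh) (FiniteImage.Build _ _ _ (@fimfunP _ _ h))
  (isNonNegFun.Build _ _ _ (@fun_ge0 _ _ h)).
by exists h'.
Qed.

Lemma integral_areaC (D : set (R * R)) (f : R * R -> \bar R) :
  (\int[@areaC R]_(z in D) f z = \int[@area R]_(z in D) f z)%E.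
Proof. by rewrite /integral !nnsfun_display. Qed.

Lemma iter_disk_intS k F v : iter_disk_int k.+1 F v =
  (\int[@area R]_(z in @diskD R) iter_disk_int k F (setvar k (toC z) v))%E.
Proof. exact: integral_areaC. Qed.

End AreaIntegral.

(** * Reduction of the disc integrals to averages over the unit interval *)

Section RadialIteration.
Variable R : realType.
Notation leb := (@lebesgue_measure R).
Notation T := (measurableTypeR R).
Notation normc := ComplexField.Normc.normc.
Notation area := (@area R).
Notation sqn := (@sqn R).
Notation diskD := (@diskD R).

Definition has_average (f : T -> T) (a : R) :=
  [/\ measurable_fun [set: T] f, leb.-integrable `[0%R, 1%R] (EFin \o f) &
      (\int[leb]_(t in `[0%R, 1%R]) (f t)%:E = a%:E)%E].

Let m01 : measurable (`[0%R, 1%R]%classic : set T).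
Proof. exact: measurable_itv. Qed.

Lemma has_average_cst c : has_average (fun=> c) c.
Proof.
have l01 : leb `[0%R, 1%R]%classic = 1%E.
  by rewrite lebesgue_measure_itv /= lte_fin ltr01 sube0.
split; first exact: measurable_cst.
  apply: continuous_compact_integrable; first exact: segment_compact.
  by apply: continuous_subspaceT => t; exact: cst_continuous.
by rewrite integral_cst// [X in (_ * X)%E]l01 mule1.
Qed.

Lemma has_averageD f g a b : has_average f a -> has_average g b ->
  has_average (fun t => f t + g t) (a + b).
Proof.
move=> [mf jf ef] [mg jg eg]; split; first exact: measurable_funD.
  by have := integrableD m01 jf jg; apply: eq_integrable.
by under eq_integral do rewrite EFinD; rewrite integralD// ef eg.
Qed.

Lemma has_averageZ c f a : has_average f a -> has_average (fun t => c * f t) (c * a).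
Proof.
move=> [mf jf ef]; split; first exact: measurable_funM.
  by have := integrableZl m01 c jf; apply: eq_integrable.
by under eq_integral do rewrite EFinM; rewrite integralZl// ef.
Qed.

Lemma has_average_sum n (f : 'I_n -> T -> T) a :
  (forall i, has_average (f i) (a i)) ->
  has_average (fun t => \sum_(i < n) f i t) (\sum_(i < n) a i).
Proof.
elim: n f a => [|n IH] f a H.
  rewrite big_ord0 (_ : (fun t => _) = fun=> 0); first exact: has_average_cst.
  by apply/funext => t; rewrite big_ord0.
rewrite big_ord_recr (_ : (fun t => _) =
    (fun t => (\sum_(i < n) f (widen_ord (leqnSn n) i) t) + f ord_max t)).
  by apply: has_averageD => //; apply: IH => i; exact: H.
by apply/funext => t; rewrite big_ord_recr.
Qed.

Lemma has_average_excess k (r : R) : 0 <= r ->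
  has_average (fun t => excess k (ln (Num.max 1 (r * t))))
    (excess k.+1 (ln (Num.max 1 r))).
Proof.
move=> r0; have c := @continuous_excess_ln R k r; split.
- exact: continuous_measurable_fun.
- apply: continuous_compact_integrable; first exact: segment_compact.
  exact: continuous_subspaceT.
- exact: integral_excess.
Qed.

Lemma has_average_log_avg n i (B : R) : 0 <= B ->
  has_average (fun t => log_avg n i (B * t)) (log_avg n.+1 i B).
Proof.
move=> B0; split; [|exact: integrable_log_avg|exact: integral_log_avg].
apply: measurableT_comp; first exact: measurable_log_avg.
exact: measurable_funM.
Qed.

Lemma integral_diskD_average f a : has_average f a ->
  (\int[area]_(z in diskD) (f (sqn z))%:E = (pi * a)%:E)%E.
Proof. by move=> [mf jf ef]; rewrite integral_diskD_sqn// ef. Qed.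

(** The coefficient [a] will be the product of the other variables of the first monomial, which may
    vanish; both integrands are then the same constant. *)
Lemma jensen_disk (a b : R[i]) : b != 0 ->
  (\int[area]_(z in diskD) (ln (normc (a * toC z + b)))%:E =
   \int[area]_(z in diskD)
     (2^-1 * ln (Num.max (normc a ^+ 2 * sqn z) (normc b ^+ 2)))%:E)%E.
Proof.
move=> b0; have nb : 0 < normc b.
  by rewrite lt_neqAle eq_sym normc_eq0 b0 normc_ge0.
have [->|a0] := eqVneq a 0.
  apply: eq_integral => z _; rewrite mul0r add0r ComplexField.Normc.normc0.
  rewrite expr0n mul0r max_r ?sqr_ge0// lnXn// -(mulr_natl (ln _)).
  by rewrite mulrA mulVf ?mul1r// pnatr_eq0.
rewrite -(normcN b) -(jensen_disk_neq0 a0) ?oppr_eq0//.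
by apply: eq_integral => z _; rewrite opprK.
Qed.

(* The closed forms below fail at the origin, because of the junk values [ln 0 = 0] and
   [x / 0 = 0]. *)
Lemma eq_integral_diskD_neq0 (f g : T * T -> \bar R) : measurable_fun [set: T * T] g ->
  (forall z, diskD z -> toC z != 0 -> f z = g z) ->
  (\int[area]_(z in diskD) f z = \int[area]_(z in diskD) g z)%E.
Proof.
move=> mg fg; pose O : set (T * T) := [set (0, 0)].
have OE : O = [set 0] `*` [set 0].
  by apply/seteqP; split => [_ ->//|[x y] /= [-> ->]].
have m0 : measurable ([set 0] : set T) by exact: measurable_set1.
have mO : measurable O by rewrite OE; exact: measurableX.
have O0 : area O = 0%E.
  rewrite OE; transitivity (leb [set 0%R] * leb [set 0%R])%E.
    exact: product_measure1E.
  by rewrite lebesgue_measure_set1 mul0e.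
have mD := @measurable_diskD R.
have eqO z : diskD z -> ~ O z -> f z = g z.
  case: z => x y Dz nz; apply: fg => //; apply: contra_notN nz.
  by rewrite eq_complex /= => /andP[/eqP -> /eqP ->].
have mDO : measurable (diskD `\` O : set (T * T)) by exact: measurableD.
(* [f] will be an iterated integral; its measurability is drawn from [g], with which it agrees off
   one point. *)
have mf : measurable_fun (diskD : set (T * T)) f.
  apply: (@measurable_funS _ _ _ _ (diskD `\` O `|` O)).
  - exact: measurableU.
  - by move=> z Dz; have [Oz|nOz] := pselect (O z); [right|left].
  apply/measurable_funU => //; split; last exact: measurable_fun_set1.
  apply: (@eq_measurable_fun _ _ _ _ _ g); last exact: measurable_funTS.
  by move=> z; rewrite inE => -[Dz nOz]; rewrite eqO.
apply: ae_eq_integral => //; first exact: measurable_funTS.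
exists O; split => // z /= h; apply: contrapT => nOz; apply: h => Dz.
exact: eqO.
Qed.

Variables m n : nat.

Let P (v : nat -> R[i]) := (ln (normc (P_xyy m n v)))%:E.

Let prod_sqr (lo hi : nat) (v : nat -> R[i]) : R :=
  \prod_(lo <= i < hi) normc (v i) ^+ 2.

Let prod_sqrE lo hi v :
  normc (\prod_(lo <= i < hi) v i) ^+ 2 = prod_sqr lo hi v.
Proof.
apply: (big_morph (fun w => normc w ^+ 2)) => [x y|].
  by rewrite ComplexField.Normc.normcM exprMn.
by rewrite ComplexField.Normc.normc1 expr1n.
Qed.

Let prod_sqr_ge0 lo hi v : 0 <= prod_sqr lo hi v.
Proof. by apply: prodr_ge0 => i _; exact: sqr_ge0. Qed.

Let prod_sqr_setvar lo hi z v : (lo < hi)%N ->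
  prod_sqr lo hi (setvar lo (toC z) v) = prod_sqr lo.+1 hi v * sqn z.
Proof.
move=> lohi; rewrite /prod_sqr big_ltn// {1}/setvar eqxx normc_toC mulrC.
congr (_ * _); apply: eq_big_nat => i /andP[li _].
by rewrite /setvar gtn_eqF.
Qed.

Let prod_sqr_setvarF lo hi k z v : (k < lo)%N ->
  prod_sqr lo hi (setvar k (toC z) v) = prod_sqr lo hi v.
Proof.
move=> klo; apply: eq_big_nat => i /andP[li _].
by rewrite /setvar gtn_eqF// (leq_trans klo).
Qed.

Let prod_sqr_gt0 lo hi v : (forall i, (lo <= i < hi)%N -> v i != 0) ->
  0 < prod_sqr lo hi v.
Proof.
move=> v0; rewrite /prod_sqr big_nat_cond; apply: prodr_gt0 => i /andP[/v0 vi _].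
by rewrite exprn_gt0// lt_neqAle eq_sym normc_eq0 vi normc_ge0.
Qed.

(* Averaging over the variables of the first monomial: only the outermost factor [pi]
   and the order [k] of the excess change from one variable to the next. *)
Lemma iter_disk_int_first k v : (k < m)%N ->
  (forall i, (m <= i < m + n)%N -> v i != 0) ->
  let B := prod_sqr m (m + n) v in
  iter_disk_int k.+1 P v =
    (pi ^+ k.+1 * (2^-1 * (ln B +
      excess k.+1 (ln (Num.max 1 (prod_sqr k.+1 m v / B))))))%:E.
Proof.
elim: k v => [|k IH] v km v0 B; have B0 : 0 < B by exact: prod_sqr_gt0.
  rewrite iter_disk_intS.
  pose a := \prod_(1 <= i < m) v i; pose b := \prod_(m <= i < m + n) v i.
  have b0 : b != 0.
    by rewrite -normc_eq0 -sqrf_eq0 /b prod_sqrE; exact: lt0r_neq0.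
  have bE : b = \prod_(j < n) v (m + j)%N.
    rewrite /b -{1}[m]add0n big_addn addKn big_mkord.
    by apply: eq_bigr => j _; rewrite addnC.
  have PE z : P (setvar 0 (toC z) v) = (ln (normc (a * toC z + b)))%:E.
    rewrite /P /P_xyy -(big_mkord predT (setvar 0 (toC z) v)) big_ltn//.
    rewrite {1}/setvar eqxx [toC z * _]mulrC; congr (ln (normc (_ * _ + _)))%:E.
      by apply: eq_big_nat => i /andP[i0 _]; rewrite /setvar gtn_eqF.
    rewrite bE; apply: eq_bigr => j _.
    by rewrite /setvar gtn_eqF// addn_gt0 km.
  transitivity (\int[area]_(z in diskD) (ln (normc (a * toC z + b)))%:E)%E.
    by apply: eq_integral => z _; rewrite -PE.
  rewrite jensen_disk// /a /b !prod_sqrE -/B.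
  (* Since [excess 0] is the identity, [ln (max (A * t) B)] is [ln B] plus [excess 0] of
     [ln (max 1 (A * t / B))]: Jensen's integrand already has the shape that averaging preserves. *)
  have avg : has_average (fun t => 2^-1 * (ln B +
      excess 0 (ln (Num.max 1 (prod_sqr 1 m v / B * t)))))
    (2^-1 * (ln B + excess 1 (ln (Num.max 1 (prod_sqr 1 m v / B))))).
    apply: has_averageZ; apply: has_averageD; first exact: has_average_cst.
    by apply: has_average_excess; rewrite divr_ge0// ltW.
  rewrite expr1 -(integral_diskD_average avg); apply: eq_integral => z _.
  have e0 L : excess 0 L = L :> R by rewrite /excess big_ord0 mulr0 addr0 subr0.
  have M0 : 0 < Num.max 1 (prod_sqr 1 m v / B * sqn z) by rewrite lt_max ltr01.
  rewrite e0 -lnM ?posrE// maxr_pMr ?(ltW B0)// mulr1 maxC.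
  by rewrite [_ * sqn z in RHS]mulrAC [B * (_ / B)]mulrC divfK// lt0r_neq0.
rewrite iter_disk_intS.
have avg : has_average (fun t => pi ^+ k.+1 * (2^-1 * (ln B +
    excess k.+1 (ln (Num.max 1 (prod_sqr k.+2 m v / B * t))))))
  (pi ^+ k.+1 * (2^-1 * (ln B + excess k.+2 (ln (Num.max 1 (prod_sqr k.+2 m v / B)))))).
  apply: has_averageZ; apply: has_averageZ; apply: has_averageD.
    exact: has_average_cst.
  by apply: has_average_excess; rewrite divr_ge0// ltW.
rewrite [X in _ = (X * _)%:E]exprS -mulrA -(integral_diskD_average avg).
apply: eq_integral => z _; rewrite IH ?(ltnW km)//; last first.
  by move=> i /andP[mi ilt]; rewrite /setvar gtn_eqF ?v0 ?mi// (leq_trans km).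
by rewrite prod_sqr_setvar ?prod_sqr_setvarF// -/B [_ * sqn z / _]mulrAC.
Qed.

(** For [j = 0] and [0 < B <= 1] this is [- E min (G_m, L)] with [L = - ln B]; [j] counts the
    variables of the second monomial already averaged. *)
Let moment_sum j (B : R) : R :=
  - m%:R + \sum_(l < m) \sum_(i < l.+1) log_avg j i B.

Let has_average_moment_sum j B : 0 <= B ->
  has_average (fun t => moment_sum j (B * t)) (moment_sum j.+1 B).
Proof.
move=> B0; apply: has_averageD; first exact: has_average_cst.
apply: has_average_sum => l; apply: has_average_sum => i.
exact: has_average_log_avg.
Qed.

(** The bound on the moduli makes [B <= 1], so that the maximum left by [iter_disk_int_first] is
    [1 / B]. Each further variable is nonzero off the centre of its disc, where
    [eq_integral_diskD_neq0] takes over. *)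
Lemma iter_disk_int_second j v : (0 < m)%N -> (j <= n)%N ->
  (forall i, (m + j <= i < m + n)%N -> v i != 0 /\ normc (v i) ^+ 2 <= 1) ->
  iter_disk_int (m + j) P v =
    (pi ^+ (m + j) * (2^-1 * moment_sum j (prod_sqr (m + j) (m + n) v)))%:E.
Proof.
move=> m0; elim: j v => [|j IH] v jn v01.
  rewrite addn0 in v01 *; have v0 i : (m <= i < m + n)%N -> v i != 0 by move/v01 => [].
  have mE : m = m.-1.+1 by rewrite prednK.
  have := @iter_disk_int_first m.-1 v; rewrite -mE leqnn => /(_ isT v0) ->.
  congr (_ * (_ * _))%:E; set B := prod_sqr m (m + n) v.
  have B0 : 0 < B by exact: prod_sqr_gt0.
  have B1 : B <= 1.
    rewrite /B /prod_sqr big_nat_cond; apply: prodr_ile1 => i /andP[/v01[_ vi] _].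
    by rewrite sqr_ge0.
  rewrite {1}/prod_sqr big_geq// max_r ?div1r ?invf_ge1// lnV ?posrE//.
  (* The leading term [L = - ln B] of [excess] cancels [ln B], and [exp (- L) = B] is the factor in
     [log_moment]. *)
  rewrite /excess opprK lnK ?posrE// /moment_sum !addrA subrr add0r; congr (_ + _).
  rewrite mulr_sumr; apply: eq_bigr => l _.
  by rewrite /exp_partial mulr_sumr.
rewrite addnS iter_disk_intS.
have avg : has_average (fun t => pi ^+ (m + j) *
    (2^-1 * moment_sum j (prod_sqr (m + j).+1 (m + n) v * t)))
  (pi ^+ (m + j) * (2^-1 * moment_sum j.+1 (prod_sqr (m + j).+1 (m + n) v))).
  by apply: has_averageZ; apply: has_averageZ; exact: has_average_moment_sum.
rewrite [X in _ = (X * _)%:E]exprS -mulrA -(integral_diskD_average avg).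
apply: eq_integral_diskD_neq0 => [|z Dz z0].
  apply/measurable_EFinP; have [mavg _ _] := avg.
  exact: measurableT_comp mavg (@measurable_sqn R).
rewrite IH ?(ltnW jn)//; last first.
  move=> i /andP[]; rewrite leq_eqVlt /setvar => /predU1P[<- _|ji ilt].
    by rewrite eqxx normc_toC.
  by rewrite gtn_eqF//; apply: v01; rewrite addnS ji.
by rewrite prod_sqr_setvar// ltn_add2l.
Qed.

End RadialIteration.

(** * Closed form of the Mahler measure *)

Section MahlerMeasure.
Variable R : realType.

Lemma mahlerD_P_xyy m n : (0 < m)%N ->
  mahlerD (m + n.+1) (@P_xyy R m n.+1) =
    (- (2^-1 * \sum_(i < m) nbin_sum R i n.+1))%:E.
Proof.
move=> m0; rewrite /mahlerD iter_disk_int_second//; last first.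
  by move=> i /andP[h1 h2]; move: (leq_trans h2 h1); rewrite ltnn.
have pi0 : pi ^+ (m + n.+1) != 0 :> R by rewrite expf_neq0// lt0r_neq0// pi_gt0.
rewrite -EFinM mulrA mulVf// mul1r -mulrN big_geq//; congr (_ * _)%:E.
(* One unit for each [l] is set against [nbin_sum n l.+1]; [nbin_sum_compl] turns the difference
   into [- nbin_sum l n.+1]. *)
have -> : m%:R = \sum_(l < m) (1 : R) by rewrite sumr_const card_ord.
rewrite -!sumrN -big_split /=; apply: eq_bigr => l _.
rewrite (eq_bigr (fun i : 'I_l.+1 => nbin R n i)); last first.
  by move=> i _; exact: log_avg_at1.
rewrite -(nbin_sum_compl R l n); change (\sum_(i < l.+1) nbin R n i) with (nbin_sum R n l.+1).
by rewrite opprD addrNK.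
Qed.

(** Reversing the sum by [j = n - r] makes [2 ^ r] the quotient of [2 ^ (p + n + 1)] by
    [2 ^ (p + j + 1)], so the sums of the theorem become race probabilities. *)
Lemma sum_bin_pow2 p n :
  \sum_(r < n.+1) 'C(p + n - r, p)%:R * 2 ^+ r =
    2 ^+ (p + n.+1) * nbin_sum R p n.+1.
Proof.
rewrite (reindex_inj rev_ord_inj) /nbin_sum mulr_sumr; apply: eq_bigr => j _ /=.
have jn : (j <= n)%N by rewrite -ltnS.
rewrite subSS (_ : (p + n - (n - j) = p + j)%N); last by rewrite -addnBA ?leq_subr// subKn.
rewrite /nbin mulrCA; congr (_ * _).
rewrite (_ : (p + n.+1 = (n - j) + (p + j).+1)%N).
  by rewrite exprD mulfK// expf_neq0// pnatr_eq0.
by rewrite !addnS addnCA subnK.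
Qed.

End MahlerMeasure.

Theorem theorem2p2 (R : realType) :
  (forall m : nat, (1 <= m)%N ->
     mahlerD (m.+1) (@P_xy R m) = ((2 ^+ m.+1)^-1 - 2^-1 : R)%:E)
  /\
  (forall m n : nat, (2 <= m)%N -> (2 <= n)%N ->
     mahlerD (m + n) (@P_xyy R m n) =
     (4^-1
      + ('C(m + n - 2, m - 1))%:R / 2 ^+ (m + n)
      - (2 ^+ (m + n))^-1 * \sum_(r < n) ('C(m + n - 3 - r, m - 2))%:R * 2 ^+ r
      - (2 ^+ (m + n))^-1 * \sum_(r < m) ('C(m + n - 3 - r, n - 2))%:R * 2 ^+ r
      - m%:R / 2 ^+ (m + n + 1) * \sum_(r < n) ('C(m + n - 1 - r, m))%:R * 2 ^+ r
      - n%:R / 2 ^+ (m + n + 1) * \sum_(r < m) ('C(m + n - 1 - r, n))%:R * 2 ^+ r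
      : R)%:E).
Proof.
split=> [m m1|m n].
  have -> : @P_xy R m = @P_xyy R m 1.
    by apply/funext => v; rewrite /P_xy /P_xyy big_ord1 addn0.
  rewrite -addn1 mahlerD_P_xyy// sum_nbin_sum1 addn1 exprS invfM.
  by congr (_%:E); ring.
case: m => [|[|m]]// _; case: n => [|[|n]]// _.
rewrite mahlerD_P_xyy//; congr (_%:E).
have -> : (m.+2 + n.+2 - 2 = m.+1 + n.+1)%N by lia.
have -> : (m.+2 + n.+2 - 3 = m + n.+1)%N by lia.
have -> : (m.+2 + n.+2 - 1 = m.+2 + n.+1)%N by lia.
have -> : (m.+2 - 1 = m.+1)%N by lia.
have -> : (m.+2 - 2 = m)%N by lia.
have -> : (n.+2 - 2 = n)%N by lia.
rewrite !sum_bin_pow2.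
have -> : (m + n.+1 = n + m.+1)%N by lia.
rewrite sum_bin_pow2.
have -> : (m.+2 + n.+1 = n.+2 + m.+1)%N by lia.
rewrite sum_bin_pow2.
(* All four sums are expressed through [s]. The first two become [s] and [1 - s], each increased by
   the same [nbin] term, so that the first four terms of the formula cancel. The last two become [s]
   and [1 - s] minus the boundary terms of [sum_nbin_sum]. *)
set s := nbin_sum R m.+1 n.+2.
have c1 : nbin_sum R m n.+2 = s + nbin R n.+1 m.+1.
  by rewrite /s nbin_sumSl subrK.
have c2 : nbin_sum R n m.+2 = 1 - s + nbin R m.+1 n.+1.
  rewrite -(nbin_sum_compl R m.+1 n.+1) -/s [s + _]addrC addrK.
  by rewrite [in RHS]nbin_sumSl subrK.
have c3 : nbin_sum R m.+2 n.+2 = s - nbin R n.+1 m.+2 by rewrite nbin_sumSl.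
have c4 : nbin_sum R n.+2 m.+2 = 1 - s - nbin R m.+1 n.+2.
  rewrite -(nbin_sum_compl R m.+1 n.+1) -/s [s + _]addrC addrK.
  by rewrite nbin_sumSl.
rewrite sum_nbin_sum -/s c1 c2 c3 c4.
rewrite (nbinC R n.+1 m.+1).
have pE : 'C(m.+1 + n.+1, m.+1)%:R / 2 ^+ (m.+2 + n.+2) = 2^-1 * nbin R m.+1 n.+1.
  rewrite /nbin (_ : (m.+2 + n.+2 = (m.+1 + n.+1).+2)%N); last by lia.
  by rewrite [in LHS]exprS invfM mulrCA.
rewrite pE; move: (nbin R m.+1 n.+1) (nbin R n.+1 m.+2) (nbin R m.+1 n.+2) => p b c.
rewrite (_ : (m.+2 + n.+2 + 1 = 3 + (m + n.+2))%N); last by lia.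
rewrite (_ : (m.+2 + n.+2 = 2 + (m + n.+2))%N); last by lia.
rewrite (_ : (n + m.+2 = m + n.+2)%N); last by lia.
rewrite (_ : (n.+2 + m.+2 = 2 + (m + n.+2))%N); last by lia.
rewrite !exprD; have : 2 ^+ (m + n.+2) != 0 :> R by rewrite expf_neq0// pnatr_eq0.
rewrite -exprD; move: (2 ^+ (m + n.+2)) (m.+2%:R : R) (n.+2%:R : R) => q x y q0.
by field.
Qed.
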